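(* Let $F\colon \mathcal{W} \to \mathbb{R}^{m\times n}$ be an affinity map (i.e. a smooth map) and let $W \colon [t_0, t_1] \to \mathcal{W}$ be a solution of the assignment flow $\dot W(t) = \mathcal{R}_{W(t)}[F(W(t))]$. Then $W$ is a critical point of the action functional $$\mathcal{L}(W) = \int_{t_0}^{t_1} \tfrac{1}{2}\|\dot{W}(t)\|_g^2 + \tfrac{1}{2}\sum_{i=1}^m \mathrm{Var}_{W_i(t)}\big(F_i(W(t))\big)\, dt$$ if and only if $F$ fulfills the condition $$0 = \mathcal{R}_{W(t)} \circ \big( dF|_{W(t)} - dF|_{W(t)}^*\big)\circ \mathcal{R}_{W(t)} [F(W(t))]\quad \text{for all } t \in [t_0, t_1].$$ Moreover, this condition is equivalent to the Euler-Lagrange equation $$D_t^g \dot{W}(t) = \tfrac{1}{2} \sum_{i=1}^m\big(\mathrm{grad}^g\, \Phi_i\big)(W(t)) \quad \text{for all } t \in [t_0, t_1],\qquad \Phi_i(W) := \mathrm{Var}_{W_i}\big(F_i(W)\big).$$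
   Context: Let $m,n$ be positive integers, and write $A_i$ for the $i$-th row of a matrix $A$, regarded as a column vector. The assignment manifold is $\mathcal{W} = \{W\in\mathbb{R}^{m\times n} : W>0 \text{ entrywise},\ W\mathbf{1}_n=\mathbf{1}_m\}$. All its tangent spaces are identified with $\mathcal{T}_0=\{V\in\mathbb{R}^{m\times n}: V\mathbf{1}_n=0\}$. It carries the (product) Fisher-Rao metric $g_W(U,V)=\sum_{i,j} U_{ij}V_{ij}/W_{ij}$ for $U,V\in\mathcal{T}_0$, and $\|V\|_g^2=g_W(V,V)$. $D_t^g$ denotes the covariant derivative along a curve with respect to the Levi-Civita connection of $g$, and $\mathrm{grad}^g$ the Riemannian gradient with respect to $g$. The replicator operator $\mathcal{R}_W\colon\mathbb{R}^{m\times n}\to\mathcal{T}_0$ is defined row-wise by $(\mathcal{R}_W[X])_i = R_{W_i}X_i$ with $R_p=\mathrm{Diag}(p)-pp^\top$. For a probability vector $p\in\mathbb{R}^n$ and $a\in\mathbb{R}^n$, $\mathrm{Var}_p(a)=\sum_j p^j (a^j)^2-\big(\sum_j p^ja^j\big)^2$. The differential $dF|_W$ is viewed as a linear map $\mathcal{T}_0\to\mathbb{R}^{m\times n}$, and $dF|_W^*\colon\mathbb{R}^{m\times n}\to\mathcal{T}_0$ is its adjoint with respect to the matrix inner product $\langle A,B\rangle=\mathrm{tr}(A^\top B)$ on $\mathbb{R}^{m\times n}$ and its restriction to $\mathcal{T}_0$. A critical point of $\mathcal{L}$ is a curve at which the first variation of $\mathcal{L}$ vanishes for all smooth variations through curves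 in $\mathcal{W}$ with fixed endpoints. *)

(* Defs.v *)
From HB Require Import structures.
From mathcomp Require Import all_boot all_order all_algebra.
From mathcomp Require Import all_classical all_reals all_analysis.

Set Implicit Arguments.
Unset Strict Implicit.
Unset Printing Implicit Defensive.

Import Order.TTheory GRing.Theory Num.Theory.
Import numFieldNormedType.Exports.

Local Open Scope classical_set_scope.
Local Open Scope ring_scope.

Section Calculus.
Context {R : realType} {V U : normedModType R}.
Implicit Types (A T : set V) (f : V -> U) (x v : V).

(* Directional derivatives of a map known only on a subset A of V: the
   increment h is restricted to those with x + h *: v in A.  This is one-sided
   differentiation at an endpoint of an interval, and 'D_v f x as soon as
   x + h *: v stays in A for small h.  It depends only on f restricted to A. *)
Definition diff_quot_within A f x v : set_system U :=
  h^-1 *: (f (x + h *: v) - f x) @[h --> within [set h : R | A (x + h *: v)] 0^'].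

Definition derivable_within A f x v : Prop := cvg (diff_quot_within A f x v).

Definition derive_within A f x v : U := lim (diff_quot_within A f x v).

Definition is_derive_within A f x v (l : U) : Prop :=
  diff_quot_within A f x v --> l.

Lemma diff_quot_withinE A f x v :
  (\forall h \near (0:R)^', A (x + h *: v)) ->
  diff_quot_within A f x v =
    (h^-1 *: ((f \o shift x) (h *: v) - f x) @[h --> 0^']).
Proof.
move=> nA; rewrite /diff_quot_within.
have -> : (fun h => h^-1 *: ((f \o shift x) (h *: v) - f x)) =
    (fun h => h^-1 *: (f (x + h *: v) - f x)).
  by apply/funext => h /=; rewrite [h *: v + x]addrC.
suff -> : within [set h : R | A (x + h *: v)] 0^' = 0^' by [].
apply/seteqP; split => B; last by move=> nB; exact: filterS nB.
by move=> wB; apply: filterS2 nA wB => h Ah; exact.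
Qed.

(* T is the set of directions tangent to A. *)
Fixpoint Ck_on A T (k : nat) f : Prop :=
  {within A, continuous f} /\
  if k is k'.+1 then
    forall v, T v ->
      (forall x, A x -> derivable_within A f x v) /\
      Ck_on A T k' (fun x => derive_within A f x v)
  else True.

Definition smooth_on A T f : Prop := forall k, Ck_on A T k f.

End Calculus.

Section AssignmentManifold.
Context {R : realType} {m n : nat}.
Local Notation M := 'M[R]_(m, n).
Implicit Types (W U V : M).

Definition assignment_manifold : set M :=
  [set W : M | (forall i j, 0 < W i j) /\ W *m const_mx 1 = const_mx 1 :> 'cV[R]_m].

Definition T0 : set M := [set V : M | V *m const_mx 1 = 0 :> 'cV[R]_m].

(* A_i : the i-th row of A as a column vector. *)
Definition rowc (A : M) (i : 'I_m) : 'cV[R]_n := (row i A)^T.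

Definition replicator_mx (p : 'cV[R]_n) : 'M[R]_n := diag_mx p^T - p *m p^T.

Definition replicator W (X : M) : M :=
  \matrix_(i, j) (replicator_mx (rowc W i) *m rowc X i) j 0.

Definition var (p a : 'cV[R]_n) : R :=
  \sum_j p j 0 * a j 0 ^+ 2 - (\sum_j p j 0 * a j 0) ^+ 2.

Definition fisher_rao W U V : R := \sum_i \sum_j U i j * V i j / W i j.

Definition mx_inner (A B : M) : R := \tr (A^T *m B).

(* dF|_W on T0, for F defined on the assignment manifold. *)
Definition dmap (F : M -> M) W V : M := derive_within assignment_manifold F W V.

(* Adjoint M -> T0 of a linear map L : T0 -> M. *)
Definition T0_adjoint (L : M -> M) (X : M) : M :=
  xget 0 [set Y : M | T0 Y /\ forall V, T0 V -> mx_inner (L V) X = mx_inner V Y].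

(* Riemannian gradient: the representer in T0 of dPhi|_W with respect to g_W. *)
Definition rgrad (Phi : M -> R) W : M :=
  xget 0 [set G : M | T0 G /\ forall V, T0 V ->
    fisher_rao W G V = derive_within assignment_manifold Phi W V].

Definition vector_field (X : M -> M) : Prop :=
  smooth_on assignment_manifold T0 X /\
  forall W, assignment_manifold W -> T0 (X W).

Definition scalar_field (f : M -> R) : Prop := smooth_on assignment_manifold T0 f.

(* nabla X Y W stands for (nabla_X Y)(W).  In the torsion identity, the Lie
   bracket [X, Y] is dY[X] - dX[Y], as the tangent spaces are identified
   with T0. *)
Record levi_civita (nabla : (M -> M) -> (M -> M) -> M -> M) : Prop := LeviCivita {
  lc_field : forall X Y, vector_field X -> vector_field Y ->
    vector_field (nabla X Y);
  lc_addl : forall X1 X2 Y,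
    vector_field X1 -> vector_field X2 -> vector_field Y ->
    forall W, assignment_manifold W ->
    nabla (fun P => X1 P + X2 P) Y W = nabla X1 Y W + nabla X2 Y W;
  lc_scalel : forall f X Y,
    scalar_field f -> vector_field X -> vector_field Y ->
    forall W, assignment_manifold W ->
    nabla (fun P => f P *: X P) Y W = f W *: nabla X Y W;
  lc_addr : forall X Y1 Y2,
    vector_field X -> vector_field Y1 -> vector_field Y2 ->
    forall W, assignment_manifold W ->
    nabla X (fun P => Y1 P + Y2 P) W = nabla X Y1 W + nabla X Y2 W;
  lc_leibniz : forall f X Y,
    scalar_field f -> vector_field X -> vector_field Y ->
    forall W, assignment_manifold W ->
    nabla X (fun P => f P *: Y P) W =
      f W *: nabla X Y W + derive_within assignment_manifold f W (X W) *: Y W;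
  lc_torsion_free : forall X Y, vector_field X -> vector_field Y ->
    forall W, assignment_manifold W ->
    nabla X Y W - nabla Y X W = dmap Y W (X W) - dmap X W (Y W);
  lc_metric : forall X Y Z,
    vector_field X -> vector_field Y -> vector_field Z ->
    forall W, assignment_manifold W ->
    derive_within assignment_manifold (fun P => fisher_rao P (Y P) (Z P)) W (X W) =
      fisher_rao W (nabla X Y W) (Z W) + fisher_rao W (Y W) (nabla X Z W) }.

Section Curves.
Variables (t0 t1 : R).
Implicit Types (c : R -> M).

Definition velocity c (t : R) : M := derive_within `[t0, t1] c t 1.

(* Covariant derivative along c of a field Z along c.  Constant T0-valued maps
   form a global frame of vector fields; expanding Z in that frame,
   the Leibniz rule gives D_t Z = Z' + nabla_{c'} (constant field Z t). *)
Definition covariant_derivative (nabla : (M -> M) -> (M -> M) -> M -> M)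
    c (Z : R -> M) (t : R) : M :=
  derive_within `[t0, t1] Z t 1 + nabla (cst (velocity c t)) (cst (Z t)) (c t).

Definition assignment_flow (F : M -> M) c : Prop :=
  forall t, t \in `[t0, t1] ->
    assignment_manifold (c t) /\
    is_derive_within `[t0, t1] c t 1 (replicator (c t) (F (c t))).

Definition action (F : M -> M) c : R :=
  \int[lebesgue_measure]_(t in `[t0, t1])
    (2^-1 * fisher_rao (c t) (velocity c t) (velocity c t) +
     2^-1 * \sum_i var (rowc (c t) i) (rowc (F (c t)) i)).

Definition variation c (e : R) (gamma : R -> R -> M) : Prop :=
  [/\ 0 < e,
      smooth_on (`]-e, e[ `*` `[t0, t1] : set (R * R)%type) setT
        (fun p => gamma p.1 p.2),
      forall s t, s \in `]-e, e[ -> t \in `[t0, t1] ->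
        assignment_manifold (gamma s t),
      forall t, t \in `[t0, t1] -> gamma 0 t = c t &
      forall s, s \in `]-e, e[ -> gamma s t0 = c t0 /\ gamma s t1 = c t1].

Definition critical_point (L : (R -> M) -> R) c : Prop :=
  forall e gamma, variation c e gamma ->
    is_derive (0 : R) (1 : R) (fun s => L (gamma s)) 0.

End Curves.
End AssignmentManifold.

(* Main.v *)
(* Write X(W) = R_W F(W), so that g_W(V, X(W)) = <V, F(W)> for V in T0 and the
   Lagrangian equals 1/2 |W' - X(W)|_g^2 + <W', F(W)>.  Along the flow the square
   contributes nothing to first order, and the first variation of the line integral
   of the one-form <., F> is \int <X, dF eta> - <eta, dF X> dt for a variation field
   eta.  It vanishes for all eta iff <V, dF X> = <X, dF V> for all V in T0, i.e. iff
   (dF - dF^* ) X has constant rows, which is the kernel of R_W.  On the other side,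
   the Koszul formula gives g(D_t W', V) = 1/2 Q(V) + <V, dF X> and
   1/2 dPhi(V) = 1/2 Q(V) + <X, dF V> with the same Q(V) = sum V_ij (F_ij - mean_i)^2,
   so the Euler-Lagrange equation is the same symmetry condition. *)
Require Import Defs.
From HB Require Import structures.
From mathcomp Require Import all_boot all_order all_algebra.
From mathcomp Require Import all_classical all_reals all_analysis.
From mathcomp Require Import ring lra.
Import Order.TTheory GRing.Theory Num.Theory.
Import numFieldNormedType.Exports.
Local Open Scope classical_set_scope.
Local Open Scope ring_scope.
Set Implicit Arguments.
Unset Strict Implicit.
Unset Printing Implicit Defensive.

(** * Difference quotients along a filter *)

(** Smoothness in the sense of [Ck_on] offers only iterated directional derivatives, in fixed
    directions and relative to a set: linearity in the direction and the chain rule have to be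
    earned. This is why difference quotients are treated along an arbitrary filter [G] finer than
    [0^']: the same calculus then serves straight lines in the manifold, curves on a closed interval
    with one-sided derivatives at the endpoints, and two-parameter variations on a rectangle. The
    square in the Lagrangian drops out because its base vanishes at parameter 0: divided by [s], it
    is a bounded quotient times a factor tending to 0. Integration by parts is done at each
    [s != 0], before the limit, as an exact identity whose boundary terms vanish because the
    endpoints are fixed; dominated convergence then passes to the limit. The connection [nabla] is
    known only through its axioms, and only its values on constant fields occur. *)

Lemma cvg_sum {R : realType} {U : normedModType R} {S : Type} (G : set_system S)
    (I : Type) (r : seq I) (P : pred I) (f : I -> S -> U) (l : I -> U) :
  Filter G -> (forall i, P i -> f i @ G --> l i) ->
  \sum_(i <- r | P i) f i x @[x --> G] --> \sum_(i <- r | P i) l i.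
Proof.
move=> FG fl; elim: r => [|i r IH].
  by rewrite big_nil; under eq_fun do rewrite big_nil; exact: cvg_cst.
rewrite big_cons; under eq_fun do rewrite big_cons.
by case: ifP => // Pi; apply: cvgD => //; exact: fl.
Qed.

(** The base value [y0] is an argument of its own instead of [y 0]: the filters in question live
    away from [0], and a difference of two moving values can then be given the base value [0]
    outright. *)
Definition quotient_cvg {R : realType} {U : normedModType R} (G : set_system R)
    (y : R -> U) (y0 l : U) : Prop :=
  h^-1 *: (y h - y0) @[h --> G] --> l.

Section DifferenceQuotients.
Context {R : realType} {U : normedModType R}.
Implicit Types (G : set_system R).

Lemma quotient_cvg_cvg G (y : R -> U) (y0 l : U) : Filter G -> G `=>` 0^' ->
  quotient_cvg G y y0 l -> y @ G --> y0.
Proof.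
move=> FG G0 yl.
have hG : h @[h --> G] --> (0 : R).
  by move=> B B0; apply: G0; exact: nbhs_dnbhs.
have : y0 + h *: (h^-1 *: (y h - y0)) @[h --> G] --> y0 + 0 *: l.
  by apply: cvgD; [exact: cvg_cst | exact: cvgZ].
rewrite scale0r addr0; apply: cvg_trans; apply: near_eq_cvg.
apply: G0; near=> h.
rewrite scalerA divff ?scale1r ?subrKC//.
by near: h; exact: nbhs_dnbhs_neq.
Unshelve. all: by end_near. Qed.

Lemma quotient_cvg_cst G (c : U) : Filter G -> quotient_cvg G (fun=> c) c 0.
Proof.
move=> FG; rewrite /quotient_cvg subrr.
by under eq_fun do rewrite scaler0; exact: cvg_cst.
Qed.

Lemma quotient_cvg_line G (x v : U) : Filter G -> G `=>` 0^' ->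
  quotient_cvg G (fun h => x + h *: v) x v.
Proof.
move=> FG G0; rewrite /quotient_cvg; have : v @[_ --> G] --> v by exact: cvg_cst.
apply: cvg_trans; apply: near_eq_cvg; apply: G0; near=> h.
rewrite [x + _]addrC addrK scalerA mulVf ?scale1r//.
by near: h; exact: nbhs_dnbhs_neq.
Unshelve. all: by end_near. Qed.

Lemma quotient_cvgD G (y z : R -> U) (y0 z0 l k : U) : Filter G ->
  quotient_cvg G y y0 l -> quotient_cvg G z z0 k ->
  quotient_cvg G (fun h => y h + z h) (y0 + z0) (l + k).
Proof.
move=> FG yl zk; rewrite /quotient_cvg.
under eq_fun do rewrite opprD addrACA scalerDr.
exact: cvgD.
Qed.

Lemma quotient_cvgZ G (f : R -> R) (y : R -> U) (f0 : R) (y0 : U) (a : R) (l : U) :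
  Filter G -> G `=>` 0^' ->
  quotient_cvg (U := R^o) G f f0 a -> quotient_cvg G y y0 l ->
  quotient_cvg G (fun h => f h *: y h) (f0 *: y0) (f0 *: l + a *: y0).
Proof.
move=> FG G0 fa yl.
have yc : y @ G --> y0 by apply: quotient_cvg_cvg yl.
rewrite /quotient_cvg.
suff -> : (fun h => h^-1 *: (f h *: y h - f0 *: y0)) =
  (fun h => f0 *: (h^-1 *: (y h - y0)) + (h^-1 *: (f h - f0)) *: y h).
  apply: cvgD; first exact: cvgZr.
  by apply: cvgZ.
apply/funext => h.
rewrite -[h^-1 *: (f h - f0)]/(h^-1 * (f h - f0)).
rewrite -[(h^-1 * _) *: _]scalerA [f0 *: (_ *: _)]scalerA [f0 * _]mulrC.
rewrite -[(h^-1 * _) *: _]scalerA -scalerDr.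
by congr (_ *: _); rewrite scalerBr scalerBl [RHS]addrC addrA subrK.
Qed.

Lemma quotient_cvg_sum (I : Type) (r : seq I) (P : pred I) G (y : I -> R -> U)
    (y0 l : I -> U) : Filter G ->
  (forall i, P i -> quotient_cvg G (y i) (y0 i) (l i)) ->
  quotient_cvg G (fun h => \sum_(i <- r | P i) y i h)
    (\sum_(i <- r | P i) y0 i) (\sum_(i <- r | P i) l i).
Proof.
move=> FG yl; elim: r => [|i r IH].
  by rewrite !big_nil; under eq_fun do rewrite big_nil; exact: quotient_cvg_cst.
rewrite !big_cons; under eq_fun do rewrite big_cons.
by case: ifP => // Pi; apply: quotient_cvgD => //; exact: yl.
Qed.

Lemma quotient_cvg_unique G (y : R -> U) (y0 l k : U) : ProperFilter G ->
  quotient_cvg G y y0 l -> quotient_cvg G y y0 k -> l = k.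
Proof. by move=> PG; apply: cvg_unique; exact: norm_hausdorff. Qed.

End DifferenceQuotients.

Section DifferenceQuotientsComp.
Context {R : realType}.

Lemma quotient_cvg_mx (m n : nat) (G : set_system R) (y : R -> 'M[R]_(m, n)) y0 l :
  Filter G -> (quotient_cvg G y y0 l <->
  forall i j, quotient_cvg (U := R^o) G (fun h => y h i j) (y0 i j) (l i j)).
Proof.
move=> FG; split=> [yl i j|yl].
  have := cvg_comp _ _ yl (@coord_continuous _ m n i j l).
  by apply: cvg_trans; apply: near_eq_cvg; near=> h; rewrite /= !mxE.
rewrite /quotient_cvg.
rewrite [l]matrix_sum_delta.
have -> : (fun h => h^-1 *: (y h - y0)) =
   (fun h => \sum_i \sum_j (h^-1 *: (y h i j - y0 i j)) *: delta_mx i j).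
  apply/funext => h; rewrite [LHS]matrix_sum_delta.
  by apply: eq_bigr => i _; apply: eq_bigr => j _; rewrite !mxE.
apply: cvg_sum => i _; apply: cvg_sum => j _.
by apply: cvgZl; exact: yl.
Unshelve. all: by end_near. Qed.

End DifferenceQuotientsComp.

(** * Derivatives and C^k maps relative to a set *)

Section DeriveWithin.
Context {R : realType} {V : normedModType R}.
Implicit Types (A T : set V) (x v : V).

(** Named so that [is_derive_within] is by conversion a [quotient_cvg] along this filter. *)
Definition steps A x v : set_system R := within [set h : R | A (x + h *: v)] 0^'.

#[global] Instance steps_filter A x v : Filter (steps A x v).
Proof. exact: within_filter. Qed.

Lemma steps_dnbhs A x v : steps A x v `=>` 0^'.
Proof. by move=> B; rewrite /steps; exact: cvg_within. Qed.

Lemma steps_dnbhsE A x v : (\forall h \near (0 : R)^', A (x + h *: v)) ->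
  steps A x v = 0^'.
Proof.
move=> nA; apply/seteqP; split => B; last by move=> nB; exact: filterS nB.
by move=> wB; apply: filterS2 nA wB => h Ah; exact.
Qed.

Lemma steps_in A x v : \forall h \near steps A x v, A (x + h *: v).
Proof. by rewrite /steps; exact: withinT. Qed.

(** Properness of the step filters makes limits along them unique, and so turns [is_derive_within]
    into an equation for [derive_within]. *)
Definition approachable A T : Prop :=
  forall x v, A x -> T v -> ProperFilter (steps A x v).

Context {U : normedModType R}.
Implicit Types (f g : V -> U).

Lemma derive_within_val A f x v (l : U) : ProperFilter (steps A x v) ->
  is_derive_within A f x v l -> derive_within A f x v = l.
Proof. by move=> ?; apply: cvg_lim; exact: norm_hausdorff. Qed.

Lemma derive_withinP A f x v : derivable_within A f x v ->
  is_derive_within A f x v (derive_within A f x v).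
Proof. by []. Qed.

Lemma is_derive_within_derivable A f x v l :
  is_derive_within A f x v l -> derivable_within A f x v.
Proof. by move=> fl; apply/cvg_ex; exists l. Qed.

Lemma is_derive_withinE A f x v l :
  is_derive_within A f x v l =
  quotient_cvg (steps A x v) (fun h => f (x + h *: v)) (f x) l.
Proof. by []. Qed.

Lemma eq_is_derive_within A f g x v l : A x -> {in A, f =1 g} ->
  is_derive_within A f x v l -> is_derive_within A g x v l.
Proof.
move=> Ax fg; apply: cvg_trans; apply: near_eq_cvg.
have := steps_in A x v; apply: filterS => h Ah.
by rewrite !fg// inE.
Qed.

Lemma eq_derive_within A f g x v : A x -> {in A, f =1 g} ->
  derive_within A f x v = derive_within A g x v.
Proof.
move=> Ax fg; rewrite /derive_within; congr (lim _).
rewrite /diff_quot_within; apply/seteqP; split; apply: near_eq_cvg;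
  have := steps_in A x v; apply: filterS => h Ah; by rewrite !fg// inE.
Qed.

Lemma within_continuousP A f :
  {within A, continuous f} <->
  forall x, A x -> f y @[y --> within A (nbhs x)] --> f x.
Proof. exact: subspace_continuousP. Qed.

Lemma eq_within_continuous A f g : {in A, f =1 g} ->
  {within A, continuous f} -> {within A, continuous g}.
Proof.
move=> fg /within_continuousP fc; apply/within_continuousP => x Ax.
rewrite -fg ?inE//; apply: cvg_trans (fc x Ax); apply: near_eq_cvg.
by apply: filterS (withinT A (nbhs_filter x)) => y Ay; rewrite fg ?inE.
Qed.

Lemma eq_Ck_on A T k f g : {in A, f =1 g} -> Ck_on A T k f -> Ck_on A T k g.
Proof.
elim: k f g => [|k IH] f g fg /= [fc fd].
  by split=> //; exact: eq_within_continuous fc.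
split; first exact: eq_within_continuous fc.
move=> v Tv; have [fdv Ckf] := fd v Tv; split=> [x Ax|].
  apply: (@is_derive_within_derivable _ _ _ _ (derive_within A f x v)).
  by apply: (eq_is_derive_within Ax fg); exact/derive_withinP/fdv.
by apply: IH Ckf => x /set_mem Ax; exact: eq_derive_within.
Qed.

Lemma Ck_on_continuous A T k f : Ck_on A T k f -> {within A, continuous f}.
Proof. by case: k => [|k] []. Qed.

Lemma Ck_on_cvg A T k f x : Ck_on A T k f -> A x ->
  f y @[y --> within A (nbhs x)] --> f x.
Proof. by move=> /Ck_on_continuous/within_continuousP; exact. Qed.

Lemma Ck_on_derive A T k f v : Ck_on A T k.+1 f -> T v ->
  Ck_on A T k (fun x => derive_within A f x v).
Proof. by move=> Cf Tv; exact: (Cf.2 v Tv).2. Qed.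

Lemma Ck_on_is_derive A T k f x v : Ck_on A T k.+1 f -> A x -> T v ->
  is_derive_within A f x v (derive_within A f x v).
Proof. by move=> Cf Ax Tv; exact: (Cf.2 v Tv).1. Qed.

(** Introduction rule with a formula [df] for the derivative in place of the chosen limit
    [derive_within]; the closure properties below are inductions over [k] through this rule. *)
Lemma Ck_onS A T k f (df : V -> V -> U) : approachable A T ->
  {within A, continuous f} ->
  (forall x v, A x -> T v -> is_derive_within A f x v (df x v)) ->
  (forall v, T v -> Ck_on A T k (df^~ v)) -> Ck_on A T k.+1 f.
Proof.
move=> aAT fc fd Cd; split=> // v Tv; split=> [x Ax|].
  exact: is_derive_within_derivable (fd x v Ax Tv).
apply: eq_Ck_on (Cd v Tv) => x /set_mem Ax; apply/esym.
by apply: derive_within_val; [exact: aAT | exact: fd].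
Qed.

Lemma Ck_onW A T k f : Ck_on A T k.+1 f -> Ck_on A T k f.
Proof.
elim: k f => [|k IH] f; first by case.
by move=> [fc fd]; split=> // v Tv; have [? ?] := fd v Tv; split=> //; exact: IH.
Qed.

End DeriveWithin.

Section CkAlgebra.
Context {R : realType} {V U : normedModType R}.
Implicit Types (A T : set V) (f g : V -> U).

Lemma Ck_on_cst A T k (c : U) : approachable A T -> Ck_on A T k (fun=> c).
Proof.
move=> aAT; elim: k c => [|k IH] c.
  by split=> //; apply/within_continuousP => x Ax; exact: cvg_cst.
apply: (@Ck_onS _ _ _ _ _ _ _ (fun _ _ => 0)) => //.
  by apply/within_continuousP => x Ax; exact: cvg_cst.
by move=> x v Ax Tv; exact: quotient_cvg_cst.
Qed.

Lemma Ck_onD A T k f g : approachable A T ->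
  Ck_on A T k f -> Ck_on A T k g -> Ck_on A T k (fun x => f x + g x).
Proof.
move=> aAT; elim: k f g => [|k IH] f g Cf Cg.
  split=> //; apply/within_continuousP => x Ax.
  by apply: cvgD; [exact: (Ck_on_cvg Cf) | exact: (Ck_on_cvg Cg)].
apply: (@Ck_onS _ _ _ _ _ _ _ (fun x v => derive_within A f x v + derive_within A g x v)) => //.
- apply/within_continuousP => x Ax.
  by apply: cvgD; [exact: (Ck_on_cvg Cf) | exact: (Ck_on_cvg Cg)].
- move=> x v Ax Tv; apply: quotient_cvgD.
    exact: (Cf.2 v Tv).1.
  exact: (Cg.2 v Tv).1.
- by move=> v Tv; apply: IH; [exact: (Cf.2 v Tv).2|exact: (Cg.2 v Tv).2].
Qed.

Lemma Ck_onZ A T k (a : V -> R) f : approachable A T ->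
  Ck_on (U := R^o) A T k a -> Ck_on A T k f -> Ck_on A T k (fun x => a x *: f x).
Proof.
move=> aAT; elim: k a f => [|k IH] a f Ca Cf.
  split=> //; apply/within_continuousP => x Ax.
  by apply: cvgZ; [exact: (Ck_on_cvg Ca) | exact: (Ck_on_cvg Cf)].
apply: (@Ck_onS _ _ _ _ _ _ _ (fun x v => a x *: derive_within A f x v +
   derive_within (U := R^o) A a x v *: f x)) => //.
- apply/within_continuousP => x Ax.
  by apply: cvgZ; [exact: (Ck_on_cvg Ca) | exact: (Ck_on_cvg Cf)].
- move=> x v Ax Tv; apply: quotient_cvgZ => //.
  + exact: steps_dnbhs.
  + exact: (Ca.2 v Tv).1.
  + exact: (Cf.2 v Tv).1.
- move=> v Tv; apply: Ck_onD => //.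
    by apply: IH; [exact: Ck_onW|exact: (Cf.2 v Tv).2].
  by apply: IH; [exact: (Ca.2 v Tv).2|exact: Ck_onW].
Qed.

Lemma Ck_on_sum A T k (I : Type) (r : seq I) (P : pred I) (f : I -> V -> U) :
  approachable A T ->
  (forall i, P i -> Ck_on A T k (f i)) -> Ck_on A T k (fun x => \sum_(i <- r | P i) f i x).
Proof.
move=> aAT Cf; elim: r => [|i r IH].
  by apply: eq_Ck_on (Ck_on_cst k 0 aAT) => x _; rewrite big_nil.
case: (boolP (P i)) => Pi.
  by apply: eq_Ck_on (Ck_onD aAT (Cf i Pi) IH) => x _; rewrite big_cons Pi.
by apply: eq_Ck_on IH => x _; rewrite big_cons (negbTE Pi).
Qed.

Lemma Ck_on_linear A T k f : approachable A T -> continuous f ->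
  (forall h x v, f (x + h *: v) = f x + h *: f v) -> Ck_on A T k f.
Proof.
move=> aAT fc fl.
have c : {within A, continuous f}.
  by apply/within_continuousP => x Ax; apply: cvg_within_filter; exact: fc.
case: k => [|k]; first by split.
apply: (@Ck_onS _ _ _ _ _ _ _ (fun _ v => f v)) => //.
- move=> x v Ax Tv; rewrite is_derive_withinE.
  under eq_fun do rewrite fl.
  by apply: quotient_cvg_line => //; exact: steps_dnbhs.
- by move=> v Tv; exact: Ck_on_cst.
Qed.

End CkAlgebra.

Section DeriveWithinComponents.
Context {R : realType} {V : normedModType R} {m n : nat}.
Implicit Types (A T : set V) (f : V -> 'M[R]_(m, n)).

Lemma is_derive_within_mx A f x v l :
  is_derive_within A f x v l <->
  forall i j, is_derive_within (U := R^o) A (fun y => f y i j) x v (l i j).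
Proof. exact: (quotient_cvg_mx (G := steps A x v)). Qed.

Lemma Ck_on_mx A T k f : approachable A T ->
  (forall i j, Ck_on (U := R^o) A T k (fun x => f x i j)) -> Ck_on A T k f.
Proof.
move=> aAT Cf.
apply: (@eq_Ck_on _ _ _ _ _ _ (fun x => \sum_i \sum_j f x i j *: delta_mx i j)).
  by move=> x _; rewrite [RHS]matrix_sum_delta.
apply: Ck_on_sum => // i _; apply: Ck_on_sum => // j _.
by apply: Ck_onZ => //; exact: Ck_on_cst.
Qed.

Lemma Ck_on_coord A T k f i j : approachable A T ->
  Ck_on A T k f -> Ck_on (U := R^o) A T k (fun x => f x i j).
Proof.
move=> aAT; elim: k f => [|k IH] f Cf.
  split=> //; apply/within_continuousP => x Ax.
  exact: (cvg_comp _ _ (Ck_on_cvg Cf Ax) (@coord_continuous _ m n i j (f x))).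
apply: (@Ck_onS _ _ _ _ _ _ _ (fun x v => derive_within A f x v i j)) => //.
- apply/within_continuousP => x Ax.
  exact: (cvg_comp _ _ (Ck_on_cvg Cf Ax) (@coord_continuous _ m n i j (f x))).
- move=> x v Ax Tv; apply/(is_derive_within_mx A f x v _).1.
  exact: (Cf.2 v Tv).1.
- by move=> v Tv; apply: IH; exact: (Cf.2 v Tv).2.
Qed.

End DeriveWithinComponents.

(** * Mean value theorem on the real line *)

Section RealLine.
Context {R : realType}.

Lemma quotient_cvg_is_derive (g : R -> R) (x l : R) :
  quotient_cvg (U := R^o) 0^' (fun h => g (x + h)) (g x) l -> is_derive x 1 g l.
Proof.
move=> gl.
have gl' : h^-1 *: ((g \o shift x) (h *: (1 : R)) - g x) @[h --> 0^'] --> (l : R^o).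
  apply: cvg_trans gl; apply: near_eq_cvg; near=> h.
  by rewrite /= [h *: _]mulr1 [h + x]addrC.
apply: DeriveDef; first by apply/cvg_ex; exists l.
exact: (cvg_lim (@norm_hausdorff _ R^o) gl').
Unshelve. all: by end_near. Qed.

(** Differentiability on the whole symmetric interval spares the callers a case distinction: their
    increments [a] come with either sign. *)
Lemma mvt_centered (g dg : R -> R) (a : R) :
  (forall t : R, `|t| <= `|a| -> is_derive t 1 g (dg t)) ->
  exists2 t, `|t| <= `|a| & g a - g 0 = a * dg t.
Proof.
move=> gd; have [a0|a0] := leP 0 a.
- have sub t : t \in `[0, a] -> `|t| <= `|a|.
    by rewrite in_itv/= => /andP[t0 ta]; rewrite !ger0_norm.
  have [||t ta E] := @MVT_segment _ g dg 0 a a0.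
  + by move=> t ta; apply: gd; apply: sub; exact: subset_itv_oo_cc ta.
  + apply: derivable_within_continuous => t /sub ta.
    by have [] := gd t ta.
  + by exists t; [exact: sub | rewrite E subr0 mulrC].
- have sub t : t \in `[a, 0] -> `|t| <= `|a|.
    by rewrite in_itv/= => /andP[t0 ta]; rewrite !ler0_norm ?lerN2// ltW.
  have [||t ta E] := @MVT_segment _ g dg a 0 (ltW a0).
  + by move=> t ta; apply: gd; apply: sub; exact: subset_itv_oo_cc ta.
  + apply: derivable_within_continuous => t /sub ta.
    by have [] := gd t ta.
  + exists t; first exact: sub.
    by rewrite -opprB E sub0r mulrN opprK mulrC.
Qed.

End RealLine.

(** * Chain rule on the assignment manifold *)

Section Manifold.
Context {R : realType} {m n : nat}.
Local Notation M := 'M[R]_(m, n).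
Local Notation A := (@assignment_manifold R m n).
Local Notation T := (@T0 R m n).
Implicit Types (P X Y : M).

Lemma manifoldP P : A P <-> (forall i j, 0 < P i j) /\ forall i, \sum_j P i j = 1.
Proof.
split=> -[P0 P1]; split=> //.
  move=> i; have /matrixP/(_ i 0) := P1; rewrite !mxE => <-.
  by apply: eq_bigr => j _; rewrite mxE mulr1.
apply/matrixP => i k; rewrite !mxE -[RHS](P1 i).
by apply: eq_bigr => j _; rewrite mxE mulr1.
Qed.

Lemma T0P P : T P <-> forall i, \sum_j P i j = 0.
Proof.
split=> [P1 i|P1].
  have /matrixP/(_ i 0) := P1; rewrite !mxE => P0; rewrite -[RHS]P0.
  by apply: eq_bigr => j _; rewrite mxE mulr1.
apply/matrixP => i k; rewrite !mxE -[RHS](P1 i).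
by apply: eq_bigr => j _; rewrite mxE mulr1.
Qed.

Lemma T0_0 : T 0.
Proof. by rewrite /T0/= mul0mx. Qed.

Lemma T0_D P X : T P -> T X -> T (P + X).
Proof. by rewrite /T0/= mulmxDl => -> ->; rewrite addr0. Qed.

Lemma T0_Z a P : T P -> T (a *: P).
Proof. by rewrite /T0/= -scalemxAl => ->; rewrite scaler0. Qed.

Lemma T0_sum (I : Type) (r : seq I) (Q : pred I) (f : I -> M) :
  (forall i, Q i -> T (f i)) -> T (\sum_(i <- r | Q i) f i).
Proof.
move=> Tf; elim/big_rec: _ => [|i X Qi TX]; first exact: T0_0.
by apply: T0_D => //; exact: Tf.
Qed.

Lemma manifold_shift P X : A P -> T X -> (forall i j, 0 < (P + X) i j) -> A (P + X).
Proof.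
move=> [_ P1] TX PX; split=> //.
by rewrite mulmxDl P1 TX addr0.
Qed.

Lemma manifold_diff P X : A P -> A X -> T (X - P).
Proof. by move=> [_ P1] [_ X1]; rewrite /T0/= mulmxBl P1 X1 subrr. Qed.

(** Positivity is an open condition on finitely many entries, and a tangent displacement keeps the
    row sums: the manifold is relatively open in the affine space [P + T0]. *)
Lemma near_manifold P : A P -> \forall X \near P, T (X - P) -> A X.
Proof.
move=> AP; have PX : \forall X \near P, forall i j, 0 < (X : M) i j.
  refine (@filter_forall _ _ (fun i (X : M) => forall j, 0 < X i j) (nbhs P) _ _) => i.
  refine (@filter_forall _ _ (fun j (X : M) => 0 < X i j) (nbhs P) _ _) => j.
  exact: (@coord_continuous R m n i j P _ (lt_nbhsr (AP.1 i j))).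
apply: filterS PX => X X0 TX; rewrite -[X](subrKC P).
by apply: manifold_shift => // i j; rewrite subrKC.
Qed.

(** The orthogonal projection onto [T0]. *)
Definition tproj P : M := \matrix_(i, j) (P i j - n%:R^-1 * \sum_k P i k).

Lemma T0_tproj P : T (tproj P).
Proof.
apply/T0P => i; under eq_bigr do rewrite mxE.
rewrite big_split/= sumr_const card_ord.
(* For [n = 0] the factor [n%:R^-1] is the default [0] and cannot be cancelled, but then all row
   sums are empty. *)
have [n0|n0] := eqVneq n 0%N.
  have e0 (f : 'I_n -> R) : \sum_k f k = 0.
    by rewrite big1// => -[k kn]; exfalso; move: kn; rewrite n0.
  by rewrite !e0 mulr0 oppr0 mul0rn addr0.
by rewrite mulNrn -(mulr_natl (_ * _)) mulrA divff ?pnatr_eq0// mul1r subrr.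
Qed.

Lemma tproj_id P : T P -> tproj P = P.
Proof.
by move=> /T0P P0; apply/matrixP => i j; rewrite mxE P0 mulr0 subr0.
Qed.

(** The projected matrix units span [T0] without being independent. They replace a basis, since by
    linearity of [tproj] a tangent matrix expands over them with its own entries as coefficients. *)
Definition tdelta (k : 'I_m * 'I_n) : M := tproj (delta_mx k.1 k.2).

Lemma T0_tdelta k : T (tdelta k). Proof. exact: T0_tproj. Qed.

Lemma T0_decomp P : T P -> P = \sum_k P k.1 k.2 *: tdelta k.
Proof.
move=> TP; rewrite -[LHS]tproj_id//; apply/matrixP => i j.
rewrite summxE mxE.
under [RHS]eq_bigr do rewrite mxE [tdelta _ _ _]mxE mulrBr mulrCA.
rewrite sumrB -mulr_sumr.
have E (l : 'I_n) : \sum_(k : 'I_m * 'I_n) P k.1 k.2 * (delta_mx k.1 k.2 : M) i l = P i l.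
  rewrite (bigD1 (i, l))//= !mxE !eqxx mulr1 big1 ?addr0// => -[a b] /= nab.
  rewrite mxE; case: eqP => [ia|]; last by rewrite mulr0.
  case: eqP => [lb|]; last by rewrite mulr0.
  by rewrite ia lb eqxx in nab.
rewrite E; congr (_ - _ * _).
under [RHS]eq_bigr do rewrite mulr_sumr.
by rewrite exchange_big; apply: eq_bigr => l _; rewrite E.
Qed.

Lemma steps_manifold P X : A P -> T X -> steps A P X = 0^'.
Proof.
move=> AP TX; apply: steps_dnbhsE.
apply: nbhs_dnbhs.
have c : P + h *: X @[h --> (0 : R)] --> P + 0 *: X.
  by apply: cvgD; [exact: cvg_cst | apply: cvgZl; exact: cvg_id].
rewrite scale0r addr0 in c.
have cA : \forall h \near (0 : R), T (P + h *: X - P) -> A (P + h *: X).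
  exact: (c _ (near_manifold AP)).
apply: filterS cA => h; apply; rewrite [P + _]addrC addrK; exact: T0_Z.
Qed.

Lemma approachable_manifold : approachable A T.
Proof. by move=> P X AP TX; rewrite steps_manifold//; exact: Proper_dnbhs_numFieldType. Qed.

Lemma mvt_manifold (f : M -> R) P X (a : R) : Ck_on (U := R^o) A T 1 f -> T X ->
  (forall t, `|t| <= `|a| -> A (P + t *: X)) ->
  exists2 t, `|t| <= `|a| &
    f (P + a *: X) - f P = a * derive_within (U := R^o) A f (P + t *: X) X.
Proof.
move=> Cf TX PA.
have [t ta E] : exists2 t, `|t| <= `|a| & f (P + a *: X) - f (P + 0 *: X) =
    a * derive_within (U := R^o) A f (P + t *: X) X.
  apply: (@mvt_centered _ (fun t => f (P + t *: X))
    (fun t => derive_within (U := R^o) A f (P + t *: X) X)) => t ta.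
  apply: quotient_cvg_is_derive.
  have := Ck_on_is_derive Cf (PA t ta) TX.
  rewrite is_derive_withinE steps_manifold//; last exact: PA.
  apply: cvg_trans; apply: near_eq_cvg; near=> h.
  by rewrite scalerDl addrA.
by exists t => //; rewrite -E scale0r addr0.
Unshelve. all: by end_near. Qed.

(* Moving along the directions d i one at a time, with the mean value theorem on
   each leg, needs no linearity of the derivative in the direction; linearity is
   then a consequence (derive_manifold_sum). *)
Lemma quotient_cvg_telescope (I : Type) (r : seq I) (G : set_system R)
    (a : I -> R -> R) (b : I -> R) (d : I -> M) (f : M -> R) P :
  Filter G -> G `=>` 0^' -> Ck_on (U := R^o) A T 1 f -> A P -> (forall i, T (d i)) ->
  (forall i, quotient_cvg (U := R^o) G (a i) 0 (b i)) ->
  quotient_cvg (U := R^o) G (fun h => f (P + \sum_(i <- r) a i h *: d i)) (f P)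
    (\sum_(i <- r) b i * derive_within (U := R^o) A f P (d i)).
Proof.
move=> FG G0 Cf AP Td ab.
have a0 i : a i h @[h --> G] --> (0 : R) by exact: (quotient_cvg_cvg FG G0 (ab i)).
have sum0 (s : seq I) : P + \sum_(i <- s) a i h *: d i @[h --> G] --> P.
  have : P + \sum_(i <- s) a i h *: d i @[h --> G] --> P + \sum_(i <- s) 0 *: d i.
    apply: cvgD; first exact: cvg_cst.
    by apply: cvg_sum => i _; apply: cvgZl; exact: a0.
  by rewrite [X in P + X]big1 ?addr0// => i _; rewrite scale0r.
elim: r => [|i r IH].
  rewrite big_nil; have := quotient_cvg_cst (U := R^o) (f P) FG.
  apply: cvg_trans; apply: near_eq_cvg; near=> h.
  by rewrite big_nil addr0.
pose z h := P + \sum_(i <- r) a i h *: d i.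
have zP : z h @[h --> G] --> P by exact: sum0.
pose D X := derive_within (U := R^o) A f X (d i).
(* [bad h t] says that [t] is a mean value point of the leg in direction [d i]. The choice [th h]
   falls back on [0] where there is none, which does not happen near the limit of [G]. *)
pose bad h t := `|t| <= `|a i h| /\
  f (z h + a i h *: d i) - f (z h) = a i h * D (z h + t *: d i).
pose th h := xget 0 (bad h).
have thP : \forall h \near G, bad h (th h) /\ A (z h + th h *: d i).
  have [e /= e0 eA] : exists2 e, 0 < e & forall X, `|P - X| < e -> T (X - P) -> A X.
    have /nbhs_ballP[e /= e0 eA] := near_manifold AP.
    by exists e => // X PX; apply: eA; rewrite -ball_normE.
  (* Half of the radius [e] is spent on the base point [z h] and half on the leg, so the whole leg
     stays in the manifold. *)
  have zn : \forall h \near G, `|P - z h| < e / 2.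
    by move/cvgrPdist_lt : zP; apply; rewrite divr_gt0.
  have an : \forall h \near G, `|a i h| * `|d i| < e / 2.
    have : `|a i h| * `|d i| @[h --> G] --> `|0 : R| * `|d i|.
      by apply: cvgMl; apply: cvg_norm; exact: a0.
    rewrite normr0 mul0r => /cvgrPdist_lt /(_ (e / 2)).
    move=> /(_ ltac:(by rewrite divr_gt0)); apply: filterS => h.
    by rewrite sub0r normrN ger0_norm ?mulr_ge0.
  apply: filterS2 zn an => h zh ah.
  have zA t : `|t| <= `|a i h| -> A (z h + t *: d i).
    move=> tle; apply: eA; last first.
      rewrite /z -(addrA P) [P + _]addrC addrK; apply: T0_D; last exact: T0_Z.
      by apply: T0_sum => k _; exact: T0_Z.
    rewrite opprD addrA; apply: le_lt_trans (ler_normB _ _) _.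
    rewrite (splitr e) ltrD// normrZ; apply: le_lt_trans ah.
    by rewrite ler_wpM2r.
  have [t tle tE] := mvt_manifold Cf (Td i) zA.
  have bt : bad h (th h) by apply: (@xgetPex _ 0 (bad h)); exists t.
  by split=> //; apply: zA; exact: bt.1.
have th0 : th h @[h --> G] --> (0 : R).
  apply/cvgrPdist_lt => e e0.
  have /cvgrPdist_lt/(_ e e0) := a0 i.
  apply: filterS2 thP => h [[tle _] _]; rewrite !sub0r !normrN.
  exact: le_lt_trans.
(* Continuity of the derivative within the manifold enters here: the mean value points stay inside
   and converge to [P]. *)
have Dc : D (z h + th h *: d i) @[h --> G] --> D P.
  have zt : z h + th h *: d i @[h --> G] --> within A (nbhs P).
    move=> B wB; have c : z h + th h *: d i @[h --> G] --> P + 0 *: d i.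
      by apply: cvgD => //; apply: cvgZl.
    rewrite scale0r addr0 in c.
    have := c _ wB; apply: filterS2 thP => h [_ Ah] /= ABh.
    exact: ABh.
  exact: (cvg_comp _ _ zt (Ck_on_cvg (Ck_on_derive Cf (Td i)) AP)).
have step : quotient_cvg (U := R^o) G (fun h => f (z h + a i h *: d i) - f (z h)) 0
    (b i * D P).
  have : (h^-1 * a i h) * D (z h + th h *: d i) @[h --> G] --> b i * D P.
    apply: cvgM => //; have := ab i; apply: cvg_trans; apply: near_eq_cvg; near=> h.
    by rewrite subr0.
  apply: cvg_trans; apply: near_eq_cvg.
  apply: filterS thP => h [[_ E] _]; rewrite subr0 E.
  by rewrite /GRing.scale/= mulrA.
rewrite big_cons.
have := quotient_cvgD FG step IH; rewrite add0r.
apply: cvg_trans; apply: near_eq_cvg; near=> h.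
by rewrite big_cons -/(z h) subrK addrCA [in RHS]addrC.
Unshelve. all: by end_near. Qed.

(** A curve in the manifold differs from [P] by a tangent matrix; its entries are the coefficients
    over [tdelta] to which the telescoping argument applies. *)
Lemma quotient_cvg_comp_sum (G : set_system R) (f : M -> R) (y : R -> M) P X :
  Filter G -> G `=>` 0^' -> Ck_on (U := R^o) A T 1 f -> A P ->
  (\forall h \near G, A (y h)) -> quotient_cvg G y P X ->
  quotient_cvg (U := R^o) G (fun h => f (y h)) (f P)
    (\sum_k X k.1 k.2 * derive_within (U := R^o) A f P (tdelta k)).
Proof.
move=> FG G0 Cf AP Ay yX.
have : quotient_cvg (U := R^o) G
    (fun h => f (P + \sum_k (y h - P) k.1 k.2 *: tdelta k)) (f P)
    (\sum_k X k.1 k.2 * derive_within (U := R^o) A f P (tdelta k)).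
  apply: (@quotient_cvg_telescope _ (index_enum ('I_m * 'I_n)%type) G
    (fun k h => (y h - P) k.1 k.2) (fun k => X k.1 k.2) tdelta) => //.
    exact: T0_tdelta.
  move=> k; have := (quotient_cvg_mx y P X FG).1 yX k.1 k.2.
  apply: cvg_trans; apply: near_eq_cvg; near=> h.
  by rewrite subr0 !mxE.
apply: cvg_trans; apply: near_eq_cvg; apply: filterS Ay => h Ah.
by rewrite -T0_decomp ?subrKC//; exact: manifold_diff.
Unshelve. all: by end_near. Qed.

Lemma derive_manifold_sum (f : M -> R) P X : Ck_on (U := R^o) A T 1 f -> A P -> T X ->
  derive_within (U := R^o) A f P X =
  \sum_k X k.1 k.2 * derive_within (U := R^o) A f P (tdelta k).
Proof.
move=> Cf AP TX; apply: derive_within_val; first exact: approachable_manifold.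
rewrite is_derive_withinE; apply: quotient_cvg_comp_sum => //.
- exact: steps_dnbhs.
- exact: steps_in.
by apply: quotient_cvg_line => //; exact: steps_dnbhs.
Qed.

Lemma quotient_cvg_comp (G : set_system R) (f : M -> R) (y : R -> M) P X :
  Filter G -> G `=>` 0^' -> Ck_on (U := R^o) A T 1 f -> A P -> T X ->
  (\forall h \near G, A (y h)) -> quotient_cvg G y P X ->
  quotient_cvg (U := R^o) G (fun h => f (y h)) (f P) (derive_within (U := R^o) A f P X).
Proof.
by move=> FG G0 Cf AP TX Ay yX; rewrite derive_manifold_sum//; exact: quotient_cvg_comp_sum.
Qed.

End Manifold.

(** * Products and inverses of real-valued functions *)

Section RealQuotients.
Context {R : realType}.
Implicit Types (G : set_system R) (f g : R -> R).

Lemma quotient_cvgM G f g (f0 g0 a b : R) : Filter G -> G `=>` 0^' ->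
  quotient_cvg (U := R^o) G f f0 a -> quotient_cvg (U := R^o) G g g0 b ->
  quotient_cvg (U := R^o) G (fun h => f h * g h) (f0 * g0) (f0 * b + a * g0).
Proof. by move=> FG G0; exact: quotient_cvgZ. Qed.

Lemma quotient_cvgB G f g (f0 g0 a b : R) : Filter G ->
  quotient_cvg (U := R^o) G f f0 a -> quotient_cvg (U := R^o) G g g0 b ->
  quotient_cvg (U := R^o) G (fun h => f h - g h) (f0 - g0) (a - b).
Proof.
move=> FG fa gb.
have : h^-1 * (f h - f0) - h^-1 * (g h - g0) @[h --> G] --> a - b by exact: cvgB.
apply: cvg_trans; apply: near_eq_cvg.
by near=> h; rewrite -mulrBr; congr (_ * _); ring.
Unshelve. all: by end_near. Qed.

Lemma quotient_cvgV G f (f0 a : R) : Filter G -> G `=>` 0^' -> f0 != 0 ->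
  quotient_cvg (U := R^o) G f f0 a ->
  quotient_cvg (U := R^o) G (fun h => (f h)^-1) f0^-1 (- (a / f0 ^+ 2)).
Proof.
move=> FG G0 f00 fa.
have fc : f h @[h --> G] --> f0 by exact: (quotient_cvg_cvg FG G0 fa).
have nf : \forall h \near G, f h != 0.
  move/cvgrPdist_lt : (fc) => /(_ `|f0|); rewrite normr_gt0 => /(_ f00).
  apply: filterS => h; apply: contraTneq => ->.
  by rewrite subr0 ltxx.
have : - ((h^-1 * (f h - f0)) * ((f h)^-1 / f0)) @[h --> G] --> - (a * (f0^-1 / f0)).
  apply: cvgN; apply: cvgM; first exact: fa.
  by apply: cvgM; [exact: cvgV | exact: cvg_cst].
rewrite -invfM -expr2; apply: cvg_trans; apply: near_eq_cvg.
apply: filterS nf => h fh; rewrite /GRing.scale/= -mulrA -mulrN; congr (_ * _).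
by field; rewrite f00.
Qed.

End RealQuotients.

Section RealCk.
Context {R : realType} {V : normedModType R}.
Implicit Types (A T : set V) (f g : V -> R).

Lemma Ck_onM A T k f g : approachable A T ->
  Ck_on (U := R^o) A T k f -> Ck_on (U := R^o) A T k g ->
  Ck_on (U := R^o) A T k (fun x => f x * g x).
Proof. exact: Ck_onZ. Qed.

Lemma Ck_onB A T k f g : approachable A T ->
  Ck_on (U := R^o) A T k f -> Ck_on (U := R^o) A T k g ->
  Ck_on (U := R^o) A T k (fun x => f x - g x).
Proof.
move=> aAT Cf Cg; apply: Ck_onD => //.
apply: eq_Ck_on (Ck_onM aAT (Ck_on_cst (U := R^o) k (-1) aAT) Cg) => x _.
by rewrite mulN1r.
Qed.

End RealCk.

(** * Algebra of the replicator and of the Fisher-Rao metric *)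

Section Algebra.
Context {R : realType} {m n : nat}.
Local Notation M := 'M[R]_(m, n).
Local Notation A := (@assignment_manifold R m n).
Local Notation T := (@T0 R m n).
Implicit Types (P X Y Z V : M).

Definition row_mean P X i : R := \sum_k P i k * X i k.

Lemma replicatorE P X i j :
  replicator P X i j = P i j * (X i j - row_mean P X i).
Proof.
rewrite /replicator mxE /replicator_mx mulmxBl -mulmxA !mxE.
rewrite (bigD1 j)//= big1 ?addr0 => [|k kj]; last first.
  by rewrite !mxE eq_sym (negbTE kj) mulr0n mul0r.
rewrite !mxE eqxx mulr1n big_ord1 !mxE mulrBr; congr (_ - _ * _).
by apply: eq_bigr => k _; rewrite !mxE.
Qed.

Lemma varE P X i : var (rowc P i) (rowc X i) =
  \sum_j P i j * X i j ^+ 2 - row_mean P X i ^+ 2.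
Proof.
rewrite /var /row_mean; congr (_ - _ ^+ 2); apply: eq_bigr => j _; by rewrite !mxE.
Qed.

Lemma mx_innerE X Y : mx_inner X Y = \sum_i \sum_j X i j * Y i j.
Proof.
rewrite /mx_inner /mxtrace exchange_big; apply: eq_bigr => j _.
by rewrite mxE; apply: eq_bigr => i _; rewrite mxE.
Qed.

Lemma T0_replicator P X : A P -> T (replicator P X).
Proof.
move=> /manifoldP[_ P1]; apply/T0P => i.
under eq_bigr do rewrite replicatorE mulrBr.
by rewrite sumrB -mulr_suml P1 mul1r subrr.
Qed.

Lemma fisher_raoC P X Y : fisher_rao P X Y = fisher_rao P Y X.
Proof.
by apply: eq_bigr => i _; apply: eq_bigr => j _; rewrite [X i j * _]mulrC.
Qed.

Lemma fisher_raoDl P X Y Z :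
  fisher_rao P (X + Y) Z = fisher_rao P X Z + fisher_rao P Y Z.
Proof.
rewrite /fisher_rao -big_split; apply: eq_bigr => i _ /=.
by rewrite -big_split; apply: eq_bigr => j _ /=; rewrite mxE !mulrDl.
Qed.

Lemma fisher_raoZl P a X Z : fisher_rao P (a *: X) Z = a * fisher_rao P X Z.
Proof.
rewrite /fisher_rao mulr_sumr; apply: eq_bigr => i _ /=.
by rewrite mulr_sumr; apply: eq_bigr => j _ /=; rewrite mxE !mulrA.
Qed.

Lemma fisher_rao_suml P (I : Type) (r : seq I) (Q : pred I) (f : I -> M) Z :
  fisher_rao P (\sum_(i <- r | Q i) f i) Z = \sum_(i <- r | Q i) fisher_rao P (f i) Z.
Proof.
elim/big_rec2: _ => [|i x y _ E].
  by rewrite -(scale0r 0) fisher_raoZl mul0r.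
by rewrite fisher_raoDl E.
Qed.

(** The metric divides by the weight that the replicator puts in, and the row mean pairs to zero
    with a tangent [V]. So the replicator turns a Euclidean representer into a Riemannian one. *)
Lemma fisher_rao_replicator P X V : A P -> T V ->
  fisher_rao P (replicator P X) V = mx_inner X V.
Proof.
move=> AP /T0P V0; rewrite mx_innerE; apply: eq_bigr => i _.
transitivity (\sum_j (X i j * V i j - row_mean P X i * V i j)).
  apply: eq_bigr => j _; rewrite replicatorE -mulrBl.
  by field; rewrite gt_eqF// AP.1.
by rewrite sumrB -mulr_sumr V0 mulr0 subr0.
Qed.

Lemma fisher_rao_eq0 P X : A P -> fisher_rao P X X = 0 -> X = 0.
Proof.
move=> AP X0.
have nn i j : 0 <= X i j * X i j / P i j.
  by rewrite divr_ge0 ?(ltW (AP.1 i j))// -expr2 sqr_ge0.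
have X1 i : \sum_j X i j * X i j / P i j = 0.
  by apply: (psumr_eq0P _ X0) => // k _; apply: sumr_ge0.
apply/matrixP => i j; rewrite mxE.
have /eqP := psumr_eq0P (fun k _ => nn i k) (X1 i) (i := j) isT.
by rewrite mulf_eq0 invr_eq0 (gt_eqF (AP.1 i j)) orbF mulf_eq0 orbb => /eqP.
Qed.

Lemma fisher_rao_inj P X Y : A P -> T X -> T Y ->
  (forall V, T V -> fisher_rao P X V = fisher_rao P Y V) -> X = Y.
Proof.
move=> AP TX TY XY; apply/eqP; rewrite -subr_eq0; apply/eqP.
have TXY : T (X - Y) by rewrite -scaleN1r; apply: T0_D => //; exact: T0_Z.
apply: (fisher_rao_eq0 AP).
rewrite fisher_raoDl (XY _ TXY) -fisher_raoDl subrr.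
by rewrite -[X in fisher_rao P X _](scale0r 0) fisher_raoZl mul0r.
Qed.

(** The right side is the sum of the row variances of [Z]: the replicator is positive semidefinite
    for the Euclidean inner product. *)
Lemma mx_inner_replicator P Z : A P ->
  mx_inner (replicator P Z) Z = \sum_i \sum_j P i j * (Z i j - row_mean P Z i) ^+ 2.
Proof.
move=> AP; rewrite mx_innerE; apply: eq_bigr => i _.
have /T0P/(_ i) := T0_replicator Z AP.
under eq_bigr do rewrite replicatorE.
move=> E; transitivity (\sum_j P i j * (Z i j - row_mean P Z i) * Z i j -
   row_mean P Z i * \sum_j P i j * (Z i j - row_mean P Z i)).
  by rewrite E mulr0 subr0; apply: eq_bigr => j _; rewrite replicatorE.
by rewrite mulr_sumr -sumrB; apply: eq_bigr => j _; ring.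
Qed.

Lemma mx_inner_replicator_ge0 P Z : A P -> 0 <= mx_inner (replicator P Z) Z.
Proof.
move=> AP; rewrite mx_inner_replicator//; apply: sumr_ge0 => i _; apply: sumr_ge0 => j _.
by rewrite mulr_ge0 ?sqr_ge0// ltW// AP.1.
Qed.

Lemma replicator_eq0 P Z : A P -> mx_inner (replicator P Z) Z = 0 -> replicator P Z = 0.
Proof.
move=> AP; rewrite mx_inner_replicator// => Z0.
have nn i j : 0 <= P i j * (Z i j - row_mean P Z i) ^+ 2.
  by rewrite mulr_ge0 ?sqr_ge0// ltW// AP.1.
have Z1 i : \sum_j P i j * (Z i j - row_mean P Z i) ^+ 2 = 0.
  by apply: (psumr_eq0P _ Z0) => // k _; apply: sumr_ge0.
apply/matrixP => i j; rewrite replicatorE mxE.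
have /eqP := psumr_eq0P (fun k _ => nn i k) (Z1 i) (i := j) isT.
by rewrite mulf_eq0 sqrf_eq0 -mulf_eq0 => /eqP.
Qed.

(** The kernel of the replicator is the orthogonal complement of [T0]. For the converse,
    [replicator P Z] is itself an admissible [V], and its pairing with [Z] is the sum of the row
    variances. *)
Lemma replicator_eq0P P Z : A P ->
  0 = replicator P Z <-> forall V, T V -> mx_inner V Z = 0.
Proof.
move=> AP; split=> [Z0 V /T0P V0|Z0].
  rewrite mx_innerE big1// => i _.
  transitivity (\sum_j V i j * row_mean P Z i).
    apply: eq_bigr => j _; congr (_ * _); apply/eqP; rewrite -subr_eq0; apply/eqP.
    apply: (mulfI (lt0r_neq0 (AP.1 i j))).
    by rewrite -replicatorE -Z0 mxE mulr0.
  by rewrite -mulr_suml V0 mul0r.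
by apply/esym/replicator_eq0 => //; exact/Z0/T0_replicator.
Qed.

Lemma mx_inner_tproj V Y : T V -> mx_inner V (tproj Y) = mx_inner V Y.
Proof.
move=> /T0P V0; rewrite !mx_innerE; apply: eq_bigr => i _.
under eq_bigr do rewrite mxE mulrBr.
by rewrite sumrB -mulr_suml V0 mul0r subr0.
Qed.

Lemma mx_innerC X Y : mx_inner X Y = mx_inner Y X.
Proof. by rewrite !mx_innerE; apply: eq_bigr => i _; apply: eq_bigr => j _; rewrite mulrC. Qed.

Lemma mx_innerDl X Y Z : mx_inner (X + Y) Z = mx_inner X Z + mx_inner Y Z.
Proof. by rewrite /mx_inner linearD/= mulmxDl mxtraceD. Qed.

Lemma mx_innerZl a X Z : mx_inner (a *: X) Z = a * mx_inner X Z.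
Proof. by rewrite /mx_inner linearZ/= -scalemxAl mxtraceZ. Qed.

Lemma mx_innerBr X Y Z : mx_inner Z (X - Y) = mx_inner Z X - mx_inner Z Y.
Proof. by rewrite /mx_inner mulmxBr linearB. Qed.

Lemma mx_inner_suml (I : Type) (r : seq I) (Q : pred I) (f : I -> M) Z :
  mx_inner (\sum_(i <- r | Q i) f i) Z = \sum_(i <- r | Q i) mx_inner (f i) Z.
Proof.
elim/big_rec2: _ => [|i x y _ E].
  by rewrite -(scale0r 0) mx_innerZl mul0r.
by rewrite mx_innerDl E.
Qed.

End Algebra.

(** * Differential of the affinity map and its adjoint *)

Section Differential.
Context {R : realType} {m n : nat}.
Local Notation M := 'M[R]_(m, n).
Local Notation A := (@assignment_manifold R m n).
Local Notation T := (@T0 R m n).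
Implicit Types (P X Y Z V : M).

Lemma quotient_cvg_line_coord (G : set_system R) P V : Filter G -> G `=>` 0^' ->
  forall i j, quotient_cvg (U := R^o) G (fun h => (P + h *: V) i j) (P i j) (V i j).
Proof.
by move=> FG G0; apply/(quotient_cvg_mx _ _ _ FG).1; exact: quotient_cvg_line.
Qed.

Lemma Ck_on_coordinate k i j : Ck_on (U := R^o) A T k (fun P : M => P i j).
Proof.
apply: Ck_on_linear; [exact: approachable_manifold | exact: coord_continuous |].
by move=> h P V; rewrite !mxE.
Qed.

Variable F : M -> M.
Hypothesis F_smooth : smooth_on A T F.

Lemma Ck_F_coord k i j : Ck_on (U := R^o) A T k (fun P => F P i j).
Proof. by apply: Ck_on_coord; [exact: approachable_manifold | exact: F_smooth]. Qed.

Lemma dmap_coord P V i j : A P -> T V ->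
  dmap F P V i j = derive_within (U := R^o) A (fun Q => F Q i j) P V.
Proof.
move=> AP TV; apply/esym/derive_within_val; first exact: approachable_manifold.
exact: ((is_derive_within_mx _ _ _ _ _).1 (Ck_on_is_derive (F_smooth 1) AP TV)).
Qed.

Lemma dmap_sum P V : A P -> T V ->
  dmap F P V = \sum_k V k.1 k.2 *: dmap F P (tdelta k).
Proof.
move=> AP TV; apply/matrixP => i j; rewrite dmap_coord// derive_manifold_sum//; last first.
  exact: Ck_F_coord.
rewrite summxE; apply: eq_bigr => k _.
by rewrite mxE dmap_coord//; exact: T0_tdelta.
Qed.

Lemma quotient_cvg_dmap (G : set_system R) (y : R -> M) P V :
  Filter G -> G `=>` 0^' -> A P -> T V ->
  (\forall h \near G, A (y h)) -> quotient_cvg G y P V ->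
  quotient_cvg G (fun h => F (y h)) (F P) (dmap F P V).
Proof.
move=> FG G0 AP TV Ay yV; apply/(quotient_cvg_mx _ _ _ FG).2 => i j.
rewrite dmap_coord//; apply: (quotient_cvg_comp (f := fun Q => F Q i j)) => //.
exact: Ck_F_coord.
Qed.

(** An explicit representer of the adjoint against tangent matrices. Its smoothness in [P] can be
    read off, which is not so for the choice made in [T0_adjoint]. *)
Definition adjoint_mx P Y : M := \matrix_(i, j) mx_inner (dmap F P (tdelta (i, j))) Y.

Lemma mx_inner_adjoint_mx P V Y : A P -> T V ->
  mx_inner (dmap F P V) Y = mx_inner V (adjoint_mx P Y).
Proof.
move=> AP TV; rewrite dmap_sum// mx_inner_suml [RHS]mx_innerE [RHS]pair_big.
by apply: eq_bigr => -[i j] _ /=; rewrite mx_innerZl mxE.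
Qed.

(** The projected [adjoint_mx] is a witness, so the [xget] in [T0_adjoint] does not fall back on its
    default [0]. *)
Lemma T0_adjointP P Y : A P -> T (T0_adjoint (dmap F P) Y) /\
  forall V, T V -> mx_inner (dmap F P V) Y = mx_inner V (T0_adjoint (dmap F P) Y).
Proof.
move=> AP; pose S Z := T Z /\ forall V, T V -> mx_inner (dmap F P V) Y = mx_inner V Z.
apply: (@xgetPex _ 0 S); exists (tproj (adjoint_mx P Y)); split; first exact: T0_tproj.
by move=> V TV; rewrite mx_inner_tproj// -mx_inner_adjoint_mx.
Qed.

Lemma symmetry_conditionE P X : A P -> T X ->
  0 = replicator P (dmap F P X - T0_adjoint (dmap F P) X) <->
  forall V, T V -> mx_inner V (dmap F P X) = mx_inner X (dmap F P V).
Proof.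
move=> AP TX; have [_ adj] := T0_adjointP X AP.
apply: (iff_trans (replicator_eq0P _ AP)); split=> E V TV; have := E V TV.
  by move/eqP; rewrite mx_innerBr -adj// subr_eq0 => /eqP ->; exact: mx_innerC.
by rewrite mx_innerBr -adj// => ->; rewrite mx_innerC subrr.
Qed.

End Differential.

(** * Fisher-Rao connection and gradients *)

Section LeviCivitaConnection.
Context {R : realType} {m n : nat}.
Local Notation M := 'M[R]_(m, n).
Local Notation A := (@assignment_manifold R m n).
Local Notation T := (@T0 R m n).
Implicit Types (P X Y Z V : M).
Variable nabla : (M -> M) -> (M -> M) -> M -> M.
Hypothesis nabla_lc : levi_civita nabla.

Lemma vector_field_cst V : T V -> vector_field (cst V).
Proof.
by move=> TV; split=> // k; apply: Ck_on_cst; exact: approachable_manifold.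
Qed.

Lemma derive_fisher_rao P X Y Z : A P -> T X ->
  derive_within A (fun Q => fisher_rao Q Y Z) P X =
  - \sum_i \sum_j X i j * Y i j * Z i j / P i j ^+ 2.
Proof.
move=> AP TX; apply: (derive_within_val (U := R^o)); first exact: approachable_manifold.
rewrite is_derive_withinE /fisher_rao -sumrN; apply: quotient_cvg_sum => i _.
rewrite -sumrN; apply: quotient_cvg_sum => j _.
have -> : - (X i j * Y i j * Z i j / P i j ^+ 2) =
    Y i j * Z i j * (- (X i j / P i j ^+ 2)) + 0 / P i j by ring.
apply: quotient_cvgM; [exact: steps_dnbhs|exact: quotient_cvg_cst|].
apply: quotient_cvgV; [exact: steps_dnbhs|by rewrite gt_eqF// AP.1|].
exact: (quotient_cvg_line_coord _ _ (@steps_dnbhs _ _ A P X)).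
Qed.

Lemma nabla_cst_T0 P X Y : A P -> T X -> T Y -> T (nabla (cst X) (cst Y) P).
Proof.
move=> AP TX TY.
have [_] := lc_field nabla_lc (vector_field_cst TX) (vector_field_cst TY).
exact.
Qed.

Lemma dmap_cst P X Y : A P -> T X -> dmap (cst Y) P X = 0.
Proof.
move=> AP TX; apply: derive_within_val; first exact: approachable_manifold.
exact: quotient_cvg_cst.
Qed.

(* The Koszul formula for constant fields: all brackets vanish. *)
Lemma fisher_rao_nabla_cst P X Y Z : A P -> T X -> T Y -> T Z ->
  fisher_rao P (nabla (cst X) (cst Y) P) Z =
  - (2^-1 * \sum_i \sum_j X i j * Y i j * Z i j / P i j ^+ 2).
Proof.
move=> AP TX TY TZ.
pose S := fun X Y Z : M => \sum_i \sum_j X i j * Y i j * Z i j / P i j ^+ 2.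
pose N := fun X Y Z : M => fisher_rao P (nabla (cst X) (cst Y) P) Z.
have SC12 U V W : S U V W = S V U W.
  by apply: eq_bigr => i _; apply: eq_bigr => j _; congr (_ * _ / _); rewrite mulrC.
have SC23 U V W : S U V W = S U W V.
  by apply: eq_bigr => i _; apply: eq_bigr => j _; congr (_ / _); rewrite mulrAC.
have metric U V W : T U -> T V -> T W -> - S U V W = N U V W + N U W V.
  move=> TU TV TW; rewrite /N [fisher_rao P _ V]fisher_raoC.
  rewrite -(lc_metric nabla_lc (vector_field_cst TU) (vector_field_cst TV)
    (vector_field_cst TW) AP).
  by rewrite derive_fisher_rao.
have torsion U V W : T U -> T V -> N U V W = N V U W.
  move=> TU TV; rewrite /N.
  have := lc_torsion_free nabla_lc (vector_field_cst TU) (vector_field_cst TV) AP.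
  by rewrite !dmap_cst// subrr => /eqP; rewrite subr_eq0 => /eqP ->.
(* By torsion-freeness and the total symmetry of [S], the three cyclic identities involve just three
   values of [N], and the sum of any two of them is [- S X Y Z]. Hence each is half of it. *)
have := metric X Y Z TX TY TZ; have := metric Y Z X TY TZ TX; have := metric Z X Y TZ TX TY.
rewrite (torsion Y X)// (torsion Z X)// (torsion Z Y)//.
rewrite -/(S X Y Z) -/(N X Y Z) (SC12 Z X Y) (SC23 X Z Y) (SC23 Y Z X) (SC12 Y X Z).
by lra.
Qed.

End LeviCivitaConnection.

(** * Derivatives and gradients of the row variances *)

Section EulerLagrange.
Context {R : realType} {m n : nat}.
Local Notation M := 'M[R]_(m, n).
Local Notation A := (@assignment_manifold R m n).
Local Notation T := (@T0 R m n).
Implicit Types (P X Y Z V : M).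

Lemma quotient_cvg_row_mean (G : set_system R) (y z : R -> M) P V Z D i :
  Filter G -> G `=>` 0^' -> quotient_cvg G y P V -> quotient_cvg G z Z D ->
  quotient_cvg (U := R^o) G (fun h => row_mean (y h) (z h) i) (row_mean P Z i)
    (\sum_k (P i k * D i k + V i k * Z i k)).
Proof.
move=> FG G0 /(quotient_cvg_mx _ _ _ FG).1 yV /(quotient_cvg_mx _ _ _ FG).1 zD.
by apply: quotient_cvg_sum => k _; exact: quotient_cvgM.
Qed.

Lemma quotient_cvg_replicator (G : set_system R) (y z : R -> M) P V Z D :
  Filter G -> G `=>` 0^' -> quotient_cvg G y P V -> quotient_cvg G z Z D ->
  quotient_cvg G (fun h => replicator (y h) (z h)) (replicator P Z)
    (\matrix_(i, j) (P i j * (D i j - \sum_k (P i k * D i k + V i k * Z i k)) +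
                     V i j * (Z i j - row_mean P Z i))).
Proof.
move=> FG G0 yV zD; apply/(quotient_cvg_mx _ _ _ FG).2 => i j.
rewrite replicatorE mxE; under eq_fun do rewrite replicatorE.
have yVij := (quotient_cvg_mx _ _ _ FG).1 yV i j.
have zDij := (quotient_cvg_mx _ _ _ FG).1 zD i j.
by apply: quotient_cvgM => //; apply: quotient_cvgB => //; exact: quotient_cvg_row_mean.
Qed.

Lemma quotient_cvg_var (G : set_system R) (y z : R -> M) P V Z D i :
  Filter G -> G `=>` 0^' -> quotient_cvg G y P V -> quotient_cvg G z Z D ->
  quotient_cvg (U := R^o) G (fun h => var (rowc (y h) i) (rowc (z h) i))
    (var (rowc P i) (rowc Z i))
    (\sum_j (P i j * (Z i j * D i j + D i j * Z i j) + V i j * (Z i j * Z i j)) -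
     (row_mean P Z i * (\sum_k (P i k * D i k + V i k * Z i k)) +
      (\sum_k (P i k * D i k + V i k * Z i k)) * row_mean P Z i)).
Proof.
move=> FG G0 yV zD; rewrite varE; under eq_fun do rewrite varE.
have /= yVij := (quotient_cvg_mx _ _ _ FG).1 yV.
have /= zDij := (quotient_cvg_mx _ _ _ FG).1 zD.
apply: quotient_cvgB.
  apply: quotient_cvg_sum => j _.
  by apply: quotient_cvgM => //; exact: quotient_cvgM.
by apply: quotient_cvgM => //; exact: quotient_cvg_row_mean.
Qed.

Variable F : M -> M.
Hypothesis F_smooth : smooth_on A T F.
Local Notation Phi i := (fun P => var (rowc P i) (rowc (F P) i)).

Lemma Ck_Phi k i : Ck_on (U := R^o) A T k (Phi i).
Proof.
have aAT := approachable_manifold (R := R) (m := m) (n := n).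
apply: (@eq_Ck_on _ _ _ _ _ _ (fun P => \sum_j P i j * (F P i j * F P i j) -
  (\sum_j P i j * F P i j) * (\sum_j P i j * F P i j) : R^o)).
  by move=> P _; rewrite varE.
apply: Ck_onB => //; last apply: Ck_onM => //; apply: Ck_on_sum => // j _;
  repeat (apply: Ck_onM => //); by [exact: Ck_on_coordinate | exact: Ck_F_coord].
Qed.

Lemma derive_Phi P V i : A P -> T V ->
  derive_within A (Phi i) P V =
  \sum_j V i j * (F P i j - row_mean P (F P) i) ^+ 2 +
  2 * \sum_j replicator P (F P) i j * dmap F P V i j.
Proof.
move=> AP TV; apply: (derive_within_val (U := R^o)); first exact: approachable_manifold.
have G0 := @steps_dnbhs _ _ A P V.
have PV : quotient_cvg (steps A P V) (fun h => P + h *: V) P V by exact: quotient_cvg_line.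
have FV := quotient_cvg_dmap F_smooth (steps_filter A P V) G0 AP TV (steps_in A P V) PV.
rewrite is_derive_withinE.
refine (eq_ind _ (quotient_cvg (U := R^o) _ _ _) (quotient_cvg_var (i := i) _ G0 PV FV) _ _).
under [X in 2 * X]eq_bigr do rewrite replicatorE.
set mu := row_mean P (F P) i; clearbody mu; set D := dmap F P V.
have V0 : \sum_j V i j = 0 by have /T0P := TV.
set S := \sum_k (P i k * D i k + V i k * F P i k).
(* The vanishing term [mu ^+ 2 * \sum_j V i j] is what completes the square
   [(F P i j - mu) ^+ 2]. *)
transitivity (\sum_j (P i j * (F P i j * D i j + D i j * F P i j) +
    V i j * (F P i j * F P i j)) - 2 * mu * S + mu ^+ 2 * \sum_j V i j).
  by rewrite V0; ring.
rewrite !mulr_sumr -sumrB -!big_split/=.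
by apply: eq_bigr => j _; ring.
Qed.

(** The gradient exists as the replicator of the matrix of derivatives along [tdelta], so the [xget]
    in [rgrad] does not return its default. *)
Lemma rgrad_PhiP P i : A P -> T (rgrad (Phi i) P) /\
  forall V, T V -> fisher_rao P (rgrad (Phi i) P) V = derive_within A (Phi i) P V.
Proof.
move=> AP; pose S G := T G /\
  forall V, T V -> fisher_rao P G V = derive_within A (Phi i) P V.
apply: (@xgetPex _ 0 S).
exists (replicator P (\matrix_(k, l) derive_within (U := R^o) A (Phi i) P (tdelta (k, l)))).
split; first exact: T0_replicator.
move=> V TV; rewrite fisher_rao_replicator// [RHS](derive_manifold_sum (Ck_Phi 1 i))//.
rewrite mx_innerE [LHS]pair_big; apply: eq_bigr => -[k l] _ /=.
by rewrite mxE mulrC.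
Qed.

Lemma derive_Phi_sum P V : A P -> T V ->
  \sum_i derive_within A (Phi i) P V =
  \sum_i \sum_j V i j * (F P i j - row_mean P (F P) i) ^+ 2 +
  2 * mx_inner (replicator P (F P)) (dmap F P V).
Proof.
move=> AP TV; under eq_bigr do rewrite derive_Phi//.
by rewrite big_split/= mx_innerE mulr_sumr.
Qed.

End EulerLagrange.

(** Shrinking one admissible step [h0] gives admissible steps arbitrarily close to [0]. Its sign is
    free, so one side suffices, as at the endpoint of an interval. *)
Lemma proper_steps {R : realType} {V : normedModType R} (A : set V) (x v : V) (h0 : R) :
  h0 != 0 -> (forall r, 0 < r <= 1 -> A (x + (r * h0) *: v)) -> ProperFilter (steps A x v).
Proof.
move=> h00 Ah; apply: Build_ProperFilter.
move=> /nbhs_ballP[e /= e0 eA].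
pose r := Num.min 1 (e / 2 / `|h0|).
have r0 : 0 < r by rewrite lt_min ltr01/= divr_gt0 ?normr_gt0// divr_gt0.
apply: (eA (r * h0)).
- rewrite -ball_normE/= sub0r normrN normrM (gtr0_norm r0).
  apply: (@le_lt_trans _ _ (e / 2)); last by rewrite ltr_pdivrMr// ltr_pMr// ltr1n.
  by rewrite -ler_pdivlMr ?normr_gt0// ge_min lexx orbT.
- by rewrite mulf_eq0 (gt_eqF r0) (negbTE h00).
- by apply: Ah; rewrite r0 ge_min lexx.
Qed.

(** * Admissible steps in intervals and rectangles *)

Section Interval.
Context {R : realType} {U : normedModType R}.
Variables (t0 t1 : R) (lt_t01 : t0 < t1).

Lemma interval_step t (b : R) : t \in `[t0, t1] ->
  exists2 h0 : R, h0 != 0 & forall r, 0 < r <= 1 -> t + (r * h0) * b \in `[t0, t1].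
Proof.
rewrite in_itv/= => /andP[t0t tt1].
have [b0|b0] := eqVneq b 0.
  by exists 1 => // r _; rewrite b0 mulr0 addr0 in_itv/= t0t.
(* The step aims at [t1], or at [t0] when [t] is the right endpoint; the division by [b] makes
   [h0 * b] exactly the way to the target. *)
have [tm|tm] := ltP t t1.
- exists ((t1 - t) / b) => [|r /andP[r0 r1]].
    by rewrite mulf_neq0 ?invr_eq0// gt_eqF// subr_gt0.
  rewrite mulrA mulfVK// in_itv/=; apply/andP; split; nra.
- exists ((t0 - t) / b) => [|r /andP[r0 r1]].
    by rewrite mulf_neq0 ?invr_eq0// lt_eqF// subr_lt0 (lt_le_trans lt_t01).
  rewrite mulrA mulfVK// in_itv/=; apply/andP; split; nra.
Qed.

Lemma proper_steps_interval t : t \in `[t0, t1] ->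
  ProperFilter (steps (`[t0, t1] : set R) t 1).
Proof.
move=> /(interval_step 1)[h0 h00 ht]; apply: (proper_steps h00) => r /ht.
by [].
Qed.

Lemma approachable_rectangle (e : R) :
  approachable (`]-e, e[ `*` `[t0, t1] : set (R * R)%type) setT.
Proof.
move=> [s t] [a b] [/= se tI] _.
have [h1 h10 ht] := interval_step b tI.
have [|d /= d0 dP] := near_in_itvoo (a := - e) (b := e) (x := s); first exact: se.
(* The factor [k] shrinks the step found for the time coordinate until the first coordinate moves by
   at most [d / 2]; the [+ 1] keeps the divisor positive when [a = 0]. *)
pose k := Num.min 1 (d / 2 / (`|h1| * (`|a| + 1))).
have a1 : 0 < `|a| + 1 by rewrite ltr_wpDl.
have h1a : 0 < `|h1| * (`|a| + 1) by rewrite mulr_gt0 ?normr_gt0.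
have k0 : 0 < k by rewrite lt_min ltr01/= divr_gt0// divr_gt0.
have k1 : k <= 1 by rewrite ge_min lexx.
apply: (@proper_steps _ _ _ _ _ (k * h1)).
  by rewrite mulf_neq0// gt_eqF.
move=> r /andP[r0 r1]; split => /=; last first.
  rewrite mulrA; apply: ht; rewrite mulr_gt0//=.
  by rewrite mulr_ile1// ltW.
apply: dP; rewrite /ball_/= opprD addrA subrr sub0r normrN !normrM.
rewrite (gtr0_norm r0) (gtr0_norm k0).
have kd : k * (`|h1| * (`|a| + 1)) <= d / 2.
  by rewrite -ler_pdivlMr// ge_min lexx orbT.
apply: (@le_lt_trans _ _ (d / 2)); last by rewrite ltr_pdivrMr// ltr_pMr// ltr1n.
apply: le_trans kd; rewrite -!mulrA.
have h1p := normr_ge0 h1; have ap := normr_ge0 a.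
apply: (@le_trans _ _ (1 * (k * (`|h1| * `|a|)))).
  by rewrite ler_wpM2r// ?mulr_ge0// ltW.
by rewrite mul1r; apply: ler_wpM2l; [exact: ltW | apply: ler_wpM2l => //; rewrite lerDl].
Qed.

Lemma is_derive_within_cvg (c : R -> U) t l : is_derive_within `[t0, t1] c t 1 l ->
  c u @[u --> within `[t0, t1] (nbhs t)] --> c t.
Proof.
move=> ctl; have cc := quotient_cvg_cvg (steps_filter _ _ _) (@steps_dnbhs _ _ _ _ _) ctl.
apply/cvgrPdist_lt => e e0; move/cvgrPdist_lt : cc => /(_ e e0).
move=> /nbhs_ballP[d /= d0 dP]; apply/nbhs_ballP; exists d => //= u tu uI.
have [->|ut] := eqVneq u t; first by rewrite subrr normr0.
have tuE : t + (u - t) *: 1 = u by rewrite [_ *: 1]mulr1 subrKC.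
have := dP (u - t); rewrite /= tuE; apply => //; last by rewrite subr_eq0.
by move: tu; rewrite -!ball_normE/= sub0r normrN distrC.
Qed.

Lemma quotient_cvg_affine (G : set_system R) (c : R -> U) t b l :
  Filter G -> G `=>` 0^' -> is_derive_within `[t0, t1] c t 1 l ->
  (\forall h \near G, t + h * b \in `[t0, t1]) ->
  quotient_cvg G (fun h => c (t + h * b)) (c t) (b *: l).
Proof.
(* For [b = 0] the increments [h * b] are all zero, so they are not steps of the punctured filter
   used below. *)
move=> FG G0 ctl Gt; have [->|b0] := eqVneq b 0.
  rewrite scale0r; under eq_fun do rewrite mulr0 addr0.
  exact: quotient_cvg_cst.
have hb : h * b @[h --> G] --> steps (`[t0, t1] : set R) t 1.
  move=> B /nbhs_ballP[d /= d0 dP].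
  have : \forall h \near G, h != 0.
    have hn0 : \forall h \near (0 : R)^', h != 0 by exact: nbhs_dnbhs_neq.
    exact: G0 hn0.
  have : \forall h \near G, `|h| < d / `|b|.
    apply: G0; apply: nbhs_dnbhs; apply/nbhs_ballP; exists (d / `|b|).
      by rewrite /= divr_gt0 ?normr_gt0.
    by move=> h; rewrite -ball_normE/= sub0r normrN.
  apply: filterS3 Gt => h tI hd h0; apply: dP => /=.
  - by rewrite -ball_normE/= sub0r normrN normrM -ltr_pdivlMr// normr_gt0.
  - by rewrite mulf_neq0.
  - by rewrite [_ *: 1]mulr1.
have : b *: ((h * b)^-1 *: (c (t + (h * b) *: 1) - c t)) @[h --> G] --> b *: l.
  by apply: cvgZr; exact: (cvg_comp _ _ hb ctl).
apply: cvg_trans; apply: near_eq_cvg.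
apply: G0; near=> h; rewrite scalerA [_ *: 1]mulr1; congr (_ *: _).
by rewrite invfM mulrCA divff// mulr1.
Unshelve. all: by end_near. Qed.

End Interval.

(** * The assignment flow *)

Section Flow.
Context {R : realType} {m n : nat}.
Local Notation M := 'M[R]_(m, n).
Local Notation A := (@assignment_manifold R m n).
Local Notation T := (@T0 R m n).
Variable F : M -> M.
Hypothesis F_smooth : smooth_on A T F.
Local Notation X P := (replicator P (F P)).
Variables (t0 t1 : R) (lt_t01 : t0 < t1).
Local Notation I := [set` `[t0, t1]].
Variable W : R -> M.
Hypothesis W_flow : assignment_flow t0 t1 F W.

Lemma flow_manifold t : t \in `[t0, t1] -> A (W t).
Proof. by move=> /W_flow[]. Qed.

Lemma flow_velocity t : t \in `[t0, t1] -> velocity t0 t1 W t = X (W t).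
Proof.
move=> tI; apply: derive_within_val; first exact: proper_steps_interval.
exact: (W_flow tI).2.
Qed.

Lemma T0_flow t : t \in `[t0, t1] -> T (X (W t)).
Proof. by move=> /flow_manifold; exact: T0_replicator. Qed.

(** The velocity is differentiable because on the interval it equals [X (W u)], to which the chain
    rule for [F] and the product rule for the replicator apply. *)
Lemma flow_acceleration t : t \in `[t0, t1] ->
  derive_within I (velocity t0 t1 W) t 1 =
  \matrix_(i, j) (W t i j * (dmap F (W t) (X (W t)) i j -
       \sum_k (W t i k * dmap F (W t) (X (W t)) i k + X (W t) i k * F (W t) i k)) +
     X (W t) i j * (F (W t) i j - row_mean (W t) (F (W t)) i)).
Proof.
move=> tI; apply: derive_within_val; first exact: proper_steps_interval.
apply: (@eq_is_derive_within _ _ _ _ (fun u => X (W u))) => //.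
  by move=> u /set_mem uI; rewrite flow_velocity.
have FG := steps_filter I t (1 : R).
have G0 := @steps_dnbhs _ _ I t (1 : R).
have WX := (W_flow tI).2; rewrite is_derive_withinE in WX.
have FX : quotient_cvg (steps I t 1) (fun h => F (W (t + h *: 1))) (F (W t))
    (dmap F (W t) (X (W t))).
  apply: quotient_cvg_dmap => //; [exact: flow_manifold|exact: T0_flow|].
  by apply: filterS (steps_in I t (1 : R)) => h hI; exact: flow_manifold.
exact: (quotient_cvg_replicator _ _ WX FX).
Qed.

Variable nabla : (M -> M) -> (M -> M) -> M -> M.
Hypothesis nabla_lc : levi_civita nabla.

(** The quadratic term has coefficient 1 here; the connection term, evaluated by the Koszul formula,
    takes half of it away. *)
Lemma fisher_rao_acceleration t V : t \in `[t0, t1] -> T V ->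
  fisher_rao (W t) (derive_within I (velocity t0 t1 W) t 1) V =
  \sum_i \sum_j V i j * (F (W t) i j - row_mean (W t) (F (W t)) i) ^+ 2 +
  mx_inner V (dmap F (W t) (X (W t))).
Proof.
move=> tI TV; have AW := flow_manifold tI; rewrite flow_acceleration//.
set D := dmap F _ _; clearbody D; rewrite /fisher_rao mx_innerE -big_split.
apply: eq_bigr => i _; rewrite -big_split/=.
set S := \sum_k (W t i k * D i k + X (W t) i k * F (W t) i k).
have V0 : \sum_j V i j = 0 by have /T0P := TV.
(* The sum [S] does not depend on the column, so it pairs to zero with the tangent [V]. *)
transitivity (\sum_j (V i j * (F (W t) i j - row_mean (W t) (F (W t)) i) ^+ 2 +
   V i j * D i j - S * V i j)); last by rewrite sumrB -mulr_sumr V0 mulr0 subr0.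
apply: eq_bigr => j _; rewrite mxE replicatorE -/S; clearbody S.
set mu := row_mean _ _ _; clearbody mu.
by field; rewrite gt_eqF// AW.1.
Qed.

Lemma T0_acceleration t : t \in `[t0, t1] ->
  T (derive_within I (velocity t0 t1 W) t 1).
Proof.
move=> tI; have AW := flow_manifold tI; rewrite flow_acceleration//.
set D := dmap F _ _; clearbody D; have /T0P XT := T0_flow tI.
move/manifoldP : (AW) => [_ W1].
apply/T0P => i; under eq_bigr do rewrite mxE.
set S := \sum_k (W t i k * D i k + X (W t) i k * F (W t) i k).
set mu := row_mean _ _ _; clearbody mu.
transitivity (\sum_j (W t i j * D i j + X (W t) i j * F (W t) i j) -
   S * \sum_j W t i j - mu * \sum_j X (W t) i j).
  by rewrite !mulr_sumr -!sumrB; apply: eq_bigr => j _; ring.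
by rewrite W1 XT mulr0 subr0 mulr1 subrr.
Qed.

Lemma euler_lagrangeE t : t \in `[t0, t1] ->
  covariant_derivative t0 t1 nabla W (velocity t0 t1 W) t =
    2^-1 *: \sum_i rgrad (fun P => var (rowc P i) (rowc (F P) i)) (W t) <->
  forall V, T V ->
    mx_inner V (dmap F (W t) (X (W t))) = mx_inner (X (W t)) (dmap F (W t) V).
Proof.
move=> tI; have AW := flow_manifold tI; have TX := T0_flow tI.
pose Q V := \sum_i \sum_j V i j * (F (W t) i j - row_mean (W t) (F (W t)) i) ^+ 2.
have lhs V : T V ->
    fisher_rao (W t) (covariant_derivative t0 t1 nabla W (velocity t0 t1 W) t) V =
    2^-1 * Q V + mx_inner V (dmap F (W t) (X (W t))).
  move=> TV; rewrite fisher_raoDl fisher_rao_acceleration// flow_velocity//.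
  rewrite fisher_rao_nabla_cst// -/(Q V).
  have -> : \sum_i \sum_j X (W t) i j * X (W t) i j * V i j / W t i j ^+ 2 = Q V.
    apply: eq_bigr => i _; apply: eq_bigr => j _; rewrite replicatorE.
    by field; rewrite gt_eqF// AW.1.
  by field.
have rhs V : T V -> fisher_rao (W t)
    (2^-1 *: \sum_i rgrad (fun P => var (rowc P i) (rowc (F P) i)) (W t)) V =
    2^-1 * Q V + mx_inner (X (W t)) (dmap F (W t) V).
  move=> TV; rewrite fisher_raoZl fisher_rao_suml.
  under eq_bigr do rewrite (rgrad_PhiP F_smooth _ AW).2//.
  by rewrite derive_Phi_sum// -/(Q V); field.
split=> [E V TV|E].
  by apply: (addrI (2^-1 * Q V)); rewrite -lhs// -rhs// E.
apply: (fisher_rao_inj AW).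
- apply: T0_D; first exact: T0_acceleration.
  by rewrite flow_velocity//; exact: nabla_cst_T0.
- by apply: T0_Z; apply: T0_sum => i _; exact: (rgrad_PhiP F_smooth i AW).1.
- by move=> V TV; rewrite lhs// rhs// E.
Qed.

End Flow.

(** * Smoothness of composites and of the flow *)

Section SmoothFields.
Context {R : realType} {m n : nat}.
Local Notation M := 'M[R]_(m, n).
Local Notation A := (@assignment_manifold R m n).
Local Notation T := (@T0 R m n).

Definition smooth_coords (Z : M -> M) : Prop :=
  forall k i j, Ck_on (U := R^o) A T k (fun P => Z P i j).

Let aAT := @approachable_manifold R m n.

Lemma smooth_coords_replicator Z : smooth_coords Z ->
  smooth_coords (fun P => replicator P (Z P)).
Proof.
move=> Zs k i j.
apply: (@eq_Ck_on _ _ _ _ _ _ (fun P : M => P i j * (Z P i j - row_mean P (Z P) i) : R^o)).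
  by move=> P _; rewrite replicatorE.
apply: Ck_onM => //; first exact: Ck_on_coordinate.
apply: Ck_onB => //; apply: Ck_on_sum => // l _.
by apply: Ck_onM => //; exact: Ck_on_coordinate.
Qed.

Lemma smooth_coordsB Y Z : smooth_coords Y -> smooth_coords Z ->
  smooth_coords (fun P => Y P - Z P).
Proof.
move=> Ys Zs k i j.
apply: (@eq_Ck_on _ _ _ _ _ _ (fun P : M => Y P i j - Z P i j : R^o)).
  by move=> P _; rewrite !mxE.
exact: Ck_onB.
Qed.

Variable F : M -> M.
Hypothesis F_smooth : smooth_on A T F.

Lemma Ck_on_dmap_tdelta k l i j :
  Ck_on (U := R^o) A T k (fun P => dmap F P (tdelta l) i j).
Proof.
apply: Ck_on_coord => //; apply: Ck_on_derive; first exact: (F_smooth k.+1).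
exact: T0_tdelta.
Qed.

(** [Ck_on] differentiates in fixed directions only; linearity trades the varying direction [Z P]
    for the fixed directions [tdelta l]. *)
Lemma smooth_coords_dmap Z : (forall P, A P -> T (Z P)) -> smooth_coords Z ->
  smooth_coords (fun P => dmap F P (Z P)).
Proof.
move=> TZ Zs k i j.
apply: (@eq_Ck_on _ _ _ _ _ _ (fun P : M =>
  \sum_l Z P l.1 l.2 * dmap F P (tdelta l) i j : R^o)).
  move=> P /set_mem AP; rewrite [in RHS](dmap_sum F_smooth AP (TZ P AP)) summxE.
  by apply: eq_bigr => l _; rewrite mxE.
apply: Ck_on_sum => // l _; apply: Ck_onM => //; exact: Ck_on_dmap_tdelta.
Qed.

Lemma smooth_coords_adjoint_mx Z : smooth_coords Z ->
  smooth_coords (fun P => adjoint_mx F P (Z P)).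
Proof.
move=> Zs k i j.
apply: (@eq_Ck_on _ _ _ _ _ _ (fun P : M =>
  \sum_a \sum_b dmap F P (tdelta (i, j)) a b * Z P a b : R^o)).
  by move=> P _; rewrite mxE mx_innerE.
apply: Ck_on_sum => // a _; apply: Ck_on_sum => // b _.
by apply: Ck_onM => //; exact: Ck_on_dmap_tdelta.
Qed.

Lemma smooth_coords_F : smooth_coords F.
Proof. by move=> k i j; exact: Ck_F_coord. Qed.

End SmoothFields.

Section Composition.
Context {R : realType} {m n : nat} {V : normedModType R}.
Local Notation M := 'M[R]_(m, n).
Local Notation A := (@assignment_manifold R m n).
Local Notation T := (@T0 R m n).
Variables (B S : set V) (Gamma : V -> M).
Hypothesis aBS : approachable B S.
Hypothesis AGamma : forall x, B x -> A (Gamma x).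

(** The row sums are constantly 1 along [Gamma], so their derivative is the row sum of [l] and also
    [0]. *)
Lemma T0_derive_within x v l : B x -> S v ->
  is_derive_within B Gamma x v l -> T l.
Proof.
move=> Bx Sv /is_derive_within_mx Gl; apply/T0P => i.
apply: (@quotient_cvg_unique _ R^o (steps B x v) (fun h => \sum_j Gamma (x + h *: v) i j)
  (\sum_j Gamma x i j)).
- exact: aBS.
- by apply: quotient_cvg_sum => j _; exact: Gl.
- have /manifoldP[_ ->] := AGamma Bx.
  apply: cvg_trans (quotient_cvg_cst (U := R^o) 1 (steps_filter B x v)).
  apply: near_eq_cvg; apply: filterS (steps_in B x v) => h /AGamma /manifoldP[_ ->].
  by [].
Qed.

Lemma within_continuous_manifold_comp (G : M -> R) :
  {within B, continuous Gamma} -> Ck_on (U := R^o) A T 0 G ->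
  {within B, continuous (fun x => G (Gamma x))}.
Proof.
move=> /within_continuousP Gc Gs; apply/within_continuousP => x Bx.
have Wc : Gamma y @[y --> within B (nbhs x)] --> within A (nbhs (Gamma x)).
  move=> C AC; have H := Gc x Bx _ AC.
  have {}H : nbhs x [set y | B y -> A (Gamma y) -> C (Gamma y)] := H.
  change (nbhs x [set y | B y -> C (Gamma y)]).
  by apply: filterS H => y Hy By; apply: Hy => //; exact: AGamma.
exact: (cvg_comp _ _ Wc (Ck_on_cvg Gs (AGamma Bx))).
Qed.

Lemma quotient_cvg_Ck_comp (G : M -> R) x v : Ck_on B S 1 Gamma ->
  Ck_on (U := R^o) A T 1 G -> B x -> S v ->
  is_derive_within (U := R^o) B (fun x => G (Gamma x)) x v
    (derive_within (U := R^o) A G (Gamma x) (derive_within B Gamma x v)).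
Proof.
move=> Gs Gc Bx Sv; have Gd := Ck_on_is_derive Gs Bx Sv.
apply: quotient_cvg_comp => //; first exact: steps_dnbhs.
- exact: AGamma.
- exact: T0_derive_within Gd.
- by apply: filterS (steps_in B x v) => h /AGamma.
Qed.

(** The derivative of the composite is a sum of products over the fixed directions [tdelta l]. Each
    factor has one order of smoothness less, and the one composed with [Gamma] is covered by the
    induction because [G] is general in it. *)
Lemma Ck_on_comp k (G : M -> R) : Ck_on B S k Gamma -> Ck_on (U := R^o) A T k G ->
  Ck_on (U := R^o) B S k (fun x => G (Gamma x)).
Proof.
elim: k G => [|k IH] G Gs Gc.
  by split=> //; apply: within_continuous_manifold_comp => //; exact: Ck_on_continuous Gs.
have Gc1 j (H : M -> R) : Ck_on (U := R^o) A T j.+1 H -> Ck_on (U := R^o) A T 1 H.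
  by elim: j => // j IHj /Ck_onW /IHj.
have Gs1 : Ck_on B S 1 Gamma.
  by move: Gs; clear; elim: k => // k IHk /Ck_onW /IHk.
apply: (@Ck_onS _ _ _ _ _ _ _ (fun x v => \sum_l derive_within B Gamma x v l.1 l.2 *
   derive_within (U := R^o) A G (Gamma x) (tdelta l) : R^o)) => //.
- apply: within_continuous_manifold_comp; first exact: Ck_on_continuous Gs.
  by apply: Ck_onW; exact: Gc1 Gc.
- move=> x v Bx Sv; have Gd := Ck_on_is_derive Gs Bx Sv.
  rewrite -derive_manifold_sum; last 3 first.
  + exact: Gc1 Gc.
  + exact: AGamma.
  + exact: T0_derive_within Gd.
  exact: quotient_cvg_Ck_comp (Gc1 _ _ Gc) Bx Sv.
- move=> v Sv; apply: Ck_on_sum => // l _; apply: Ck_onM => //.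
    by apply: Ck_on_coord => //; exact: Ck_on_derive.
  apply: (IH (fun P => derive_within (U := R^o) A G P (tdelta l))); first exact: Ck_onW.
  by apply: Ck_on_derive => //; exact: T0_tdelta.
Qed.

End Composition.

Section FlowSmooth.
Context {R : realType} {m n : nat}.
Local Notation M := 'M[R]_(m, n).
Local Notation A := (@assignment_manifold R m n).
Local Notation T := (@T0 R m n).
Variable F : M -> M.
Hypothesis F_smooth : smooth_on A T F.
Local Notation X P := (replicator P (F P)).
Variables (t0 t1 : R) (lt_t01 : t0 < t1).
Local Notation I := [set` `[t0, t1]].
Variable W : R -> M.
Hypothesis W_flow : assignment_flow t0 t1 F W.

Definition rectangle (e : R) : set (R * R)%type := `]-e, e[ `*` `[t0, t1].

(* Bootstrapping: W' = X(W) is as smooth as W, so W is smooth. *)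
Lemma Ck_on_flow e k : Ck_on (rectangle e) setT k (fun p => W p.2).
Proof.
have aR : approachable (rectangle e) setT := approachable_rectangle lt_t01 (e := e).
have AW := flow_manifold W_flow.
have Wc : {within rectangle e, continuous (fun p => W p.2)}.
  apply/within_continuousP => -[s t] [/= se tI].
  have c2 : p.2 @[p --> within (rectangle e) (nbhs (s, t))] --> within I (nbhs t).
    move=> B /= IB; have : p.2 @[p --> (s, t)] --> t by exact: cvg_snd.
    move=> /(_ _ IB) H.
    have {}H : nbhs (s, t) [set p : R * R | I p.2 -> B p.2] := H.
    change (nbhs (s, t) [set p : R * R | rectangle e p -> B p.2]).
    by apply: filterS H => p Hp [_ pI]; exact: Hp.
  exact: (cvg_comp _ _ c2 (is_derive_within_cvg (W_flow tI).2)).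
elim: k => [|k IH]; first by split.
apply: (@Ck_onS _ _ _ _ _ _ _ (fun p v : R * R => v.2 *: X (W p.2))) => //.
- move=> [s t] [a b] [/= se tI] _; rewrite is_derive_withinE /=.
  apply: quotient_cvg_affine; [exact: steps_dnbhs|exact: (W_flow tI).2|].
  by apply: filterS (steps_in (rectangle e) (s, t) (a, b)) => h [].
- move=> v _; apply: Ck_onZ => //; first exact: Ck_on_cst.
  apply: Ck_on_mx => // i j.
  apply: (@Ck_on_comp _ _ _ _ _ _ (fun p => W p.2) aR _ _ (fun P => X P i j)) => //.
    by move=> p [_ /AW].
  by apply: smooth_coords_replicator; exact: smooth_coords_F.
Qed.

End FlowSmooth.

(** * Integrals over the time interval *)

Section IntervalIntegrals.
Context {R : realType}.
Variables (t0 t1 : R) (lt_t01 : t0 < t1).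
Local Notation I := [set` `[t0, t1]].
Local Notation mu := (@lebesgue_measure R).
Implicit Types f g : R -> R.

Lemma continuous_integrable_itv f : {within I, continuous f} ->
  mu.-integrable I (EFin \o f).
Proof. by move=> fc; apply: continuous_compact_integrable => //; exact: segment_compact. Qed.

Lemma Rintegral_derive_within f (B : R -> R) : {within I, continuous f} ->
  (forall t, t \in `[t0, t1] -> is_derive_within (U := R^o) I B t 1 (f t)) ->
  \int[mu]_(t in I) f t = B t1 - B t0.
Proof.
move=> fc Bd; have Bc : {within I, continuous (B : R -> R^o)}.
  by apply/within_continuousP => t tI; exact: is_derive_within_cvg (Bd t tI).
have Bder t : t \in `]t0, t1[ -> is_derive t 1 B (f t).
  move=> tI; apply: quotient_cvg_is_derive.
  have /= := Bd t (subset_itv_oo_cc tI); rewrite is_derive_withinE.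
  have -> : steps I t (1 : R) = 0^'.
    apply: steps_dnbhsE; apply: nbhs_dnbhs; have [d /= d0 dP] := near_in_itvoo tI.
    apply/nbhs_ballP; exists d => //= h; rewrite -ball_normE/= sub0r normrN => hd.
    apply: subset_itv_oo_cc; apply: dP.
    by rewrite /ball_/= [h *: _]mulr1 opprD addrA subrr sub0r normrN.
  apply: cvg_trans; apply: near_eq_cvg; near=> h.
  by rewrite [h *: _]mulr1.
rewrite /Rintegral (@continuous_FTC2 _ _ B)//.
- have /(continuous_within_itvP (B : R -> R^o) lt_t01)[_ B0 B1] := Bc.
  by split=> // t /Bder[].
- by move=> t /Bder[_]; rewrite derive1E.
Unshelve. all: by end_near. Qed.

(** If [f t > 0], continuity keeps [f] above [f t / 2] on an interval of length [d / 2] to the right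
    of [t], whose share of the integral is already positive. *)
Lemma Rintegral_continuous_eq0 f : {within I, continuous f} ->
  (forall t, t \in `[t0, t1] -> 0 <= f t) -> \int[mu]_(t in I) f t = 0 ->
  forall t, t \in `]t0, t1[ -> f t = 0.
Proof.
move=> fc f0 If0 t tI; apply/eqP; rewrite eq_le f0 ?andbT; last exact: subset_itv_oo_cc.
rewrite leNgt; apply/negP => ft.
have /(continuous_within_itvP f lt_t01)[fi _ _] := fc.
have : \forall u \near t, f t / 2 < f u.
  have := fi t tI; move/cvgr_gt; apply.
  by rewrite ltr_pdivrMr// ltr_pMr// ltr1n.
move=> H; have := near_in_itvoo tI => H2.
have [d /= d0 dP] : exists2 d, 0 < d &
    forall u, `|t - u| < d -> f t / 2 < f u /\ u \in `]t0, t1[.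
  have /nbhs_ballP[d /= d0 dP] : nbhs t [set u | f t / 2 < f u /\ u \in `]t0, t1[].
    by apply: filterS2 H H2.
  by exists d => // u tu; apply: dP; rewrite -ball_normE.
pose J := [set` `[t, t + d / 2]].
have d2 : 0 < d / 2 by rewrite divr_gt0.
have Jd u : u \in `[t, t + d / 2] -> f t / 2 < f u /\ u \in `]t0, t1[.
  rewrite in_itv/= => /andP[tu utd]; apply: dP.
  rewrite ler0_norm ?subr_le0// opprB ltrBlDl; apply: le_lt_trans utd _.
  by rewrite ltrD2l ltr_pdivrMr// ltr_pMr// ltr1n.
have JI : J `<=` I by move=> u /Jd[_] /subset_itv_oo_cc.
have fint := continuous_integrable_itv fc.
have mJ : measurable (J : set (measurableTypeR R)) by exact: measurable_itv.
have mI : measurable (I : set (measurableTypeR R)) by exact: measurable_itv.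
have fJ : mu.-integrable J (EFin \o f) by exact: integrableS fint.
have le1 : \int[mu]_(u in J) (f t / 2) <= \int[mu]_(u in J) f u.
  apply: le_Rintegral => //.
    apply: continuous_compact_integrable; first exact: segment_compact.
    by apply/within_continuousP => ? _; exact: cvg_cst.
  by move=> u /Jd[/ltW].
have le2 : \int[mu]_(u in J) f u <= \int[mu]_(u in I) f u.
  rewrite /Rintegral; apply: fine_le; [exact: integrable_fin_num|exact: integrable_fin_num|].
  apply: ge0_subset_integral => //.
  by case/integrableP: fint.
have := le_trans le1 le2; rewrite If0 Rintegral_cst//.
have muJ : mu J = (d / 2)%:E.
  rewrite lebesgue_measure_itv/= lte_fin ltrDl d2 -EFinB.
  by rewrite [t + _]addrC addrK.
rewrite [X in fine X](_ : _ = (d / 2)%:E); last exact: muJ.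
rewrite /= leNgt.
by rewrite mulr_gt0// divr_gt0.
Qed.

(** The weight of the test variation vanishes at [t0] and [t1]; there an equation is recovered from
    the interior by continuity. *)
Lemma within_continuous_eq0 f : {within I, continuous f} ->
  (forall t, t \in `]t0, t1[ -> f t = 0) -> forall t, t \in `[t0, t1] -> f t = 0.
Proof.
move=> /(continuous_within_itvP f lt_t01)[_ f0 f1] foo t; rewrite in_itv/= => /andP[].
rewrite le_eqVlt => /predU1P[<- _|t0t].
  apply: (cvg_unique (@norm_hausdorff _ R^o) f0); apply: cvg_near_cst.
  near=> u; apply: foo; rewrite in_itv/=; apply/andP; split.
    by near: u; exact: nbhs_right_gt.
  by near: u; exact: nbhs_right_lt.
rewrite le_eqVlt => /predU1P[->|tt1]; last by apply: foo; rewrite in_itv/= t0t.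
apply: (cvg_unique (@norm_hausdorff _ R^o) f1); apply: cvg_near_cst.
near=> u; apply: foo; rewrite in_itv/=; apply/andP; split.
  by near: u; exact: nbhs_left_gt.
by near: u; exact: nbhs_left_lt.
Unshelve. all: by end_near. Qed.

Lemma cvg_Rintegral_dominated (K : R -> R -> R) (K0 : R -> R) (C d : R) : 0 < d ->
  (forall s, `|s| < d -> s != 0 -> {within I, continuous (K s)}) ->
  {within I, continuous K0} ->
  (forall s t, `|s| < d -> s != 0 -> t \in `[t0, t1] -> `|K s t| <= C) ->
  (forall t, t \in `[t0, t1] -> K s t @[s --> 0^'] --> K0 t) ->
  \int[mu]_(t in I) K s t @[s --> 0^'] --> \int[mu]_(t in I) K0 t.
Proof.
move=> d0 Kc K0c KC KK0; apply/cvgr_dnbhsP => u [u0 ucvg].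
have mI : measurable (I : set (measurableTypeR R)) by exact: measurable_itv.
(* The hypotheses on [K] hold only for [|s| < d], while the dominated convergence theorem wants them
   for every index; hence the shift of the sequence by [N]. *)
have [N _ uN] : \forall n \near \oo, `|u n| < d.
  by move/cvgrPdist_lt : ucvg => /(_ d d0); apply: filterS => n; rewrite sub0r normrN.
rewrite -(cvg_shiftn N)/=.
have iK n : mu.-integrable I (EFin \o K (u (n + N)%N)).
  apply: continuous_integrable_itv; apply: Kc => //.
  by apply: uN; exact: leq_addl.
have [|||||_ _] := @dominated_convergence _ _ _ mu I mI
  (fun n t => (K (u (n + N)%N) t)%:E) (fun t => (K0 t)%:E) (cst C%:E).
- by move=> n; case/integrableP : (iK n).
- by case/integrableP : (continuous_integrable_itv K0c).
- apply: aeW => t tI; apply: cvg_EFin; first by near=> n.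
  have /cvgr_dnbhsP/(_ u (conj u0 ucvg)) := KK0 t tI.
  by rewrite -(cvg_shiftn N).
- apply: continuous_compact_integrable; first exact: segment_compact.
  by apply/within_continuousP => ? _; exact: cvg_cst.
- apply: aeW => t n tI /=; rewrite lee_fin; apply: KC => //.
  by apply: uN; exact: leq_addl.
have fin : (\int[mu]_(t in I) (EFin \o K0) t)%E \is a fin_num.
  by apply: integrable_fin_num => //; exact: continuous_integrable_itv.
rewrite -[X in _ --> X -> _](fineK fin) => /fine_cvg.
exact.
Unshelve. all: by end_near. Qed.

End IntervalIntegrals.

(** * Calculus and uniform bounds on the parameter rectangle *)

Section RectangleCalculus.
Context {R : realType}.
Variables (t0 t1 : R) (lt_t01 : t0 < t1) (e : R).
Local Notation I := [set` `[t0, t1]].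
Local Notation B := (rectangle t0 t1 e).
Local Notation d1 u p := (derive_within B u p (1, 0)).
Local Notation d2 u p := (derive_within B u p (0, 1)).

Lemma approachable_B : approachable B setT.
Proof. exact: approachable_rectangle. Qed.

Lemma steps_fst s t : s \in `]-e, e[ -> t \in `[t0, t1] -> steps B (s, t) (1, 0) = 0^'.
Proof.
move=> sI tI; apply: steps_dnbhsE; apply: nbhs_dnbhs.
have [d /= d0 dP] := near_in_itvoo sI.
apply/nbhs_ballP; exists d => //= h; rewrite -ball_normE/= sub0r normrN => hd.
split=> /=; last by rewrite [h *: _]mulr0 addr0.
by apply: dP; rewrite /ball_/= [h *: _]mulr1 opprD addrA subrr sub0r normrN.
Qed.

Lemma steps_snd s t : s \in `]-e, e[ -> steps B (s, t) (0, 1) = steps I t 1.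
Proof.
move=> sI; apply: (f_equal (fun D => within D (0 : R)^')); apply/seteqP; split=> h /=.
  by move=> [].
by move=> hI; split => //=; rewrite [h *: _]mulr0 addr0.
Qed.

Lemma is_derive_within_snd (U : normedModType R) (u : R * R -> U) s t l :
  s \in `]-e, e[ -> is_derive_within B u (s, t) (0, 1) l ->
  is_derive_within I (fun t => u (s, t)) t 1 l.
Proof.
move=> sI; rewrite is_derive_withinE => ul; rewrite is_derive_withinE -(steps_snd t sI).
apply: cvg_trans ul; apply: near_eq_cvg; near=> h.
by congr (_ *: (u _ - _)); congr (_, _) => //=; rewrite [h *: _]mulr0 addr0.
Unshelve. all: by end_near. Qed.

Lemma quotient_cvg_fst (u : R * R -> R) s t : s \in `]-e, e[ -> t \in `[t0, t1] ->
  Ck_on (U := R^o) B setT 1 u ->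
  quotient_cvg (U := R^o) 0^' (fun h => u (s + h, t)) (u (s, t)) (d1 u (s, t)).
Proof.
move=> sI tI Cu; have /= := Ck_on_is_derive Cu (x := (s, t)) (v := (1, 0)) (conj sI tI) Logic.I.
rewrite is_derive_withinE steps_fst//.
apply: cvg_trans; apply: near_eq_cvg; near=> h.
congr (_ *: (u _ - _)); congr (_, _) => /=; first by rewrite [h *: _]mulr1.
by rewrite [h *: _]mulr0 addr0.
Unshelve. all: by end_near. Qed.

Lemma within_continuous_snd (u : R * R -> R) s : s \in `]-e, e[ ->
  {within B, continuous u} -> {within I, continuous (fun t => u (s, t))}.
Proof.
move=> sI /within_continuousP uc; apply/within_continuousP => t tI.
have c : (s, v) @[v --> within I (nbhs t)] --> within B (nbhs (s, t)).
  move=> C BC; have : (s, v) @[v --> t] --> (s, t).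
    by apply: (@cvg_pair _ _ _ _ (nbhs s) (nbhs t)); [exact: cvg_cst|exact: cvg_id].
  move=> /(_ _ BC) H.
  have {}H : nbhs t [set v | B (s, v) -> C (s, v)] := H.
  change (nbhs t [set v | I v -> C (s, v)]).
  by apply: filterS H => v Hv vI; exact: Hv.
exact: (cvg_comp _ _ c (uc (s, t) (conj sI tI))).
Qed.

Lemma cvg_fst_within (u : R * R -> R) t : 0 < e -> t \in `[t0, t1] ->
  {within B, continuous u} -> u (s, t) @[s --> 0^'] --> u (0, t).
Proof.
move=> e0 tI /within_continuousP uc.
have zI : 0 \in `]-e, e[ by rewrite in_itv/= oppr_lt0 e0.
have c : (s, t) @[s --> 0^'] --> within B (nbhs (0, t)).
  move=> C BC; have : (s, t) @[s --> (0 : R)^'] --> ((0 : R), t).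
    apply: (@cvg_pair _ _ _ _ (nbhs (0 : R)) (nbhs t)); last exact: cvg_cst.
    exact: nbhs_dnbhs.
  move=> /(_ _ BC) H.
  have {}H : (0 : R)^' [set s | B (s, t) -> C (s, t)] := H.
  have /nbhs_dnbhs nI := near_in_itvoo zI.
  change ((0 : R)^' [set s | C (s, t)]).
  by apply: filterS2 H nI => s Hs sI; exact: Hs.
exact: (cvg_comp _ _ c (uc (0, t) (conj zI tI))).
Qed.

(** [B] is open in [s], hence not compact; the strict inequality [d < e] leaves a closed rectangle
    inside it. *)
Lemma rectangle_bounded (u : R * R -> R) d : d < e -> {within B, continuous u} ->
  exists2 C, 0 <= C & forall s t, `|s| <= d -> t \in `[t0, t1] -> `|u (s, t)| <= C.
Proof.
move=> de uc; pose K : set (R * R) := `[-d, d] `*` `[t0, t1].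
have KB : K `<=` B.
  move=> [s t] [/= sI tI]; split=> //=; move: sI; rewrite !in_itv/= => /andP[sd ds].
  by rewrite (le_lt_trans ds)// andbT (lt_le_trans _ sd)// ltrN2.
have cK : compact K by apply: compact_setX; exact: segment_compact.
have := continuous_compact (continuous_subspaceW KB uc) cK.
move=> /compact_bounded[C [_ CP]]; exists (`|C| + 1); first by rewrite addr_ge0.
move=> s t sd tI; apply: (CP (`|C| + 1)).
  by apply: (le_lt_trans (ler_norm C)); rewrite ltrDl.
by exists (s, t) => //; split => //=; rewrite in_itv/= -ler_norml.
Qed.

(** The mean value theorem in [s] and a bound for the continuous [s]-derivative. This is the source
    of the uniform bound on difference quotients in [s] for dominated convergence. *)
Lemma rectangle_lipschitz (u : R * R -> R) d : 0 < d -> d < e ->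
  Ck_on (U := R^o) B setT 1 u ->
  exists2 C, 0 <= C & forall s t, `|s| <= d -> t \in `[t0, t1] ->
    `|u (s, t) - u (0, t)| <= C * `|s|.
Proof.
move=> d0 de Cu.
have cd : {within B, continuous (fun p => d1 u p : R^o)}.
  by apply: (@Ck_on_continuous _ _ _ _ setT 0); exact: Ck_on_derive.
have [C C0 CP] := rectangle_bounded de cd; exists C => // s t sd tI.
have [|r rs ->] := @mvt_centered _ (fun s => u (s, t)) (fun s => d1 u (s, t)) s.
  move=> r rs; apply: quotient_cvg_is_derive; apply: quotient_cvg_fst => //.
  by rewrite in_itv/= -ltr_norml (le_lt_trans _ de)// (le_trans rs).
by rewrite normrM mulrC ler_wpM2r// CP// (le_trans rs).
Qed.

End RectangleCalculus.

Section BoundedFamilies.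
Context {R : realType}.
Variables (t0 t1 d : R).

Definition bounded_family (k : R -> R -> R) : Prop :=
  exists C, forall s t, `|s| < d -> s != 0 -> t \in `[t0, t1] -> `|k s t| <= C.

Lemma bounded_familyD k l : bounded_family k -> bounded_family l ->
  bounded_family (fun s t => k s t + l s t).
Proof.
move=> [C CP] [D DP]; exists (C + D) => s t sd s0 tI.
by apply: le_trans (ler_normD _ _) _; rewrite lerD ?CP ?DP.
Qed.

Lemma bounded_familyM k l : bounded_family k -> bounded_family l ->
  bounded_family (fun s t => k s t * l s t).
Proof.
move=> [C CP] [D DP]; exists (C * D) => s t sd s0 tI.
by rewrite normrM ler_pM ?CP ?DP.
Qed.

Lemma bounded_family_cst c : bounded_family (fun _ _ => c).
Proof. by exists `|c|. Qed.

Lemma bounded_familyB k l : bounded_family k -> bounded_family l ->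
  bounded_family (fun s t => k s t - l s t).
Proof.
move=> [C CP] [D DP]; exists (C + D) => s t sd s0 tI.
by apply: le_trans (ler_normB _ _) _; rewrite lerD ?CP ?DP.
Qed.

Lemma bounded_family_sum (J : Type) (r : seq J) (k : J -> R -> R -> R) :
  (forall j, bounded_family (k j)) -> bounded_family (fun s t => \sum_(j <- r) k j s t).
Proof.
move=> kb; elim: r => [|j r [C CP]].
  by exists 0 => s t _ _ _; rewrite big_nil normr0.
have [D DP] := kb j; exists (D + C) => s t sd s0 tI; rewrite big_cons.
by apply: le_trans (ler_normD _ _) _; rewrite lerD ?CP ?DP.
Qed.

End BoundedFamilies.

(** * First variation of the action *)

Section FirstVariation.
Context {R : realType} {m n : nat}.
Local Notation M := 'M[R]_(m, n).
Local Notation A := (@assignment_manifold R m n).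
Local Notation T := (@T0 R m n).

Lemma var_centered (P Z : M) i : A P ->
  var (rowc P i) (rowc Z i) = \sum_j P i j * (Z i j - row_mean P Z i) ^+ 2.
Proof.
move=> /manifoldP[_ P1]; rewrite varE.
have E : row_mean P Z i = \sum_j P i j * Z i j by [].
set mu := row_mean P Z i in E *; clearbody mu.
transitivity (\sum_j P i j * Z i j ^+ 2 - 2 * mu * (\sum_j P i j * Z i j) + mu ^+ 2 * \sum_j P i j).
  by rewrite P1 -E; ring.
by rewrite !mulr_sumr -sumrB -big_split/=; apply: eq_bigr => j _; ring.
Qed.

(* Completing the square: the Lagrangian is a square vanishing along the flow
   plus the one-form V |-> <V, F>. *)
Lemma lagrangianE (P V Z : M) : A P -> T V ->
  2^-1 * fisher_rao P V V + 2^-1 * \sum_i var (rowc P i) (rowc Z i) =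
  2^-1 * (\sum_i \sum_j (V i j - replicator P Z i j) ^+ 2 / P i j) + mx_inner V Z.
Proof.
move=> AP /T0P V0; rewrite mx_innerE -mulrDr /fisher_rao -big_split/=.
suff -> : \sum_i (\sum_j V i j * V i j / P i j + var (rowc P i) (rowc Z i)) =
    \sum_i \sum_j (V i j - replicator P Z i j) ^+ 2 / P i j + 2 * \sum_i \sum_j V i j * Z i j.
  by field.
rewrite mulr_sumr -big_split/=; apply: eq_bigr => i _; rewrite mulr_sumr -big_split/=.
rewrite var_centered//.
(* The cross term of the square is [- 2 * V i j * (Z i j - mu)]; the part with the mean sums to zero
   because [V] is tangent. *)
transitivity (\sum_j V i j * V i j / P i j + \sum_j P i j * (Z i j - row_mean P Z i) ^+ 2
   + 2 * row_mean P Z i * \sum_j V i j); first by rewrite V0 mulr0 addr0.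
under [RHS]eq_bigr do rewrite replicatorE.
set mu := row_mean P Z i; clearbody mu.
rewrite !mulr_sumr -!big_split/=; apply: eq_bigr => j _.
by field; rewrite gt_eqF// AP.1.
Qed.

Variable F : M -> M.
Hypothesis F_smooth : smooth_on A T F.
Local Notation X P := (replicator P (F P)).
Variables (t0 t1 : R) (lt_t01 : t0 < t1).
Local Notation I := [set` `[t0, t1]].
Variable W : R -> M.
Hypothesis W_flow : assignment_flow t0 t1 F W.
Variables (e : R) (gamma : R -> R -> M).
Hypothesis gamma_var : Defs.variation t0 t1 W e gamma.
Local Notation B := (rectangle t0 t1 e).
Local Notation Gamma := (fun p : R * R => gamma p.1 p.2).
Local Notation D v p := (derive_within B Gamma p v).
Local Notation mu := (@lebesgue_measure R).

Let e0 : 0 < e. Proof. by case: gamma_var. Qed.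
Let aB : approachable B setT. Proof. exact: approachable_B. Qed.
Let zI : 0 \in `]-e, e[. Proof. by rewrite in_itv/= oppr_lt0 e0. Qed.
Let AGamma p : B p -> A (Gamma p).
Proof. by case: p => s t [sI tI]; case: gamma_var => _ _ H _ _; exact: H. Qed.
Let CGamma k : Ck_on B setT k Gamma.
Proof. by case: gamma_var => _ H _ _ _; exact: H. Qed.
Let gamma0 t : t \in `[t0, t1] -> gamma 0 t = W t.
Proof. by case: gamma_var => _ _ _ H _; exact: H. Qed.
Let BI s t : s \in `]-e, e[ -> t \in `[t0, t1] -> B (s, t).
Proof. by move=> sI tI; split. Qed.

Lemma T0_variation v p : B p -> T (D v p).
Proof.
move=> Bp; have Dp := Ck_on_is_derive (CGamma 1) Bp (v := v) Logic.I.
by apply: (T0_derive_within aB AGamma Bp _ Dp).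
Qed.

Lemma velocity_variation s t : s \in `]-e, e[ -> t \in `[t0, t1] ->
  velocity t0 t1 (gamma s) t = D (0, 1) (s, t).
Proof.
move=> sI tI; apply: derive_within_val; first exact: proper_steps_interval.
apply: (is_derive_within_snd (u := Gamma) sI).
exact: (Ck_on_is_derive (CGamma 1) (BI sI tI) Logic.I).
Qed.

Lemma velocity_variation0 t : t \in `[t0, t1] -> D (0, 1) (0, t) = X (W t).
Proof.
move=> tI; rewrite -velocity_variation// -(flow_velocity lt_t01 W_flow tI).
by apply: eq_derive_within => // u /set_mem; exact: gamma0.
Qed.

Let Cg k i j : Ck_on (U := R^o) B setT k (fun p => Gamma p i j).
Proof. exact: Ck_on_coord. Qed.
Let CD k v i j : Ck_on (U := R^o) B setT k (fun p => D v p i j).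
Proof. by apply: Ck_on_coord => //; exact: (Ck_on_derive (CGamma k.+1)). Qed.
Let Cf k i j : Ck_on (U := R^o) B setT k (fun p => F (Gamma p) i j).
Proof. by apply: (Ck_on_comp aB AGamma (G := fun P => F P i j)) => //; exact: smooth_coords_F. Qed.
Let Cx k i j : Ck_on (U := R^o) B setT k (fun p => X (Gamma p) i j).
Proof.
apply: (Ck_on_comp aB AGamma (G := fun P => X P i j)) => //.
by apply: smooth_coords_replicator; exact: smooth_coords_F.
Qed.

Let Cdf v i j : Ck_on (U := R^o) B setT 0
  (fun p => derive_within (U := R^o) B (fun p => F (Gamma p) i j) p v).
Proof. by apply: Ck_on_derive; first exact: (Cf 1). Qed.

Let derive_g v p i j : B p ->
  derive_within (U := R^o) B (fun p => Gamma p i j) p v = D v p i j.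
Proof.
move=> Bp; apply: derive_within_val; first exact: aB.
exact: ((is_derive_within_mx _ _ _ _ _).1 (Ck_on_is_derive (CGamma 1) Bp (v := v) Logic.I)).
Qed.

Let derive_f v p i j : B p ->
  derive_within (U := R^o) B (fun p => F (Gamma p) i j) p v = dmap F (Gamma p) (D v p) i j.
Proof.
move=> Bp; rewrite dmap_coord//; [|exact: AGamma|exact: T0_variation].
apply: derive_within_val; first exact: aB.
apply: (quotient_cvg_Ck_comp aB AGamma (G := fun P => F P i j)) => //.
exact: Ck_F_coord.
Qed.

(** Measures how far [gamma s] is from solving the flow. It vanishes at [s = 0] because [W] is a
    solution, which makes its square of second order in [s]. *)
Let y i j (p : R * R) : R := D (0, 1) p i j - X (Gamma p) i j.
Let Cy k i j : Ck_on (U := R^o) B setT k (y i j).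
Proof. by apply: Ck_onB. Qed.

Let L s t : R := 2^-1 * (\sum_i \sum_j y i j (s, t) ^+ 2 / gamma s t i j) +
  \sum_i \sum_j D (0, 1) (s, t) i j * F (gamma s t) i j.

Let y0 i j t : t \in `[t0, t1] -> y i j (0, t) = 0.
Proof. by move=> tI; rewrite /y velocity_variation0//= gamma0// subrr. Qed.

Let action_gamma s : s \in `]-e, e[ -> action t0 t1 F (gamma s) = \int[mu]_(t in I) L s t.
Proof.
move=> sI; apply: eq_Rintegral => t /set_mem tI.
rewrite velocity_variation// lagrangianE; [|exact: (AGamma (BI sI tI))|exact: T0_variation (BI sI tI)].
by rewrite mx_innerE.
Qed.

(* The t-derivative of \sum_ij (gamma s t - gamma 0 t)_ij F_ij(gamma s t), which
   vanishes at t0 and t1. *)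
Let b s t : R := \sum_i \sum_j
  ((gamma s t i j - gamma 0 t i j) * dmap F (gamma s t) (D (0, 1) (s, t)) i j +
   (D (0, 1) (s, t) i j - D (0, 1) (0, t) i j) * F (gamma s t) i j).

(* What remains of (L s t - L 0 t) / s after removing b s t / s: it involves no
   difference of the velocities in s, so the limit s --> 0 needs no symmetry of
   second derivatives. *)
Let K s t : R := 2^-1 * (\sum_i \sum_j s^-1 * y i j (s, t) * y i j (s, t) / gamma s t i j) +
  \sum_i \sum_j (D (0, 1) (0, t) i j * (s^-1 * (F (gamma s t) i j - F (gamma 0 t) i j)) -
    s^-1 * (gamma s t i j - gamma 0 t i j) * dmap F (gamma s t) (D (0, 1) (s, t)) i j).

Let LKb s t : s != 0 -> t \in `[t0, t1] -> L s t - L 0 t = s * K s t + b s t.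
Proof.
move=> s0 tI; rewrite /L /K /b.
have -> : \sum_i \sum_j y i j (0, t) ^+ 2 / gamma 0 t i j = 0.
  by rewrite big1// => i _; rewrite big1// => j _; rewrite y0// expr0n/= mul0r.
rewrite mulr0 add0r mulrDr [s * (2^-1 * _)]mulrCA -!addrA; congr (_ * _ + _).
  rewrite mulr_sumr; apply: eq_bigr => i _; rewrite mulr_sumr; apply: eq_bigr => j _.
  by rewrite !mulrA divff// mul1r.
rewrite mulr_sumr -sumrB -big_split/=; apply: eq_bigr => i _.
rewrite mulr_sumr -sumrB -big_split/=; apply: eq_bigr => j _.
(* A discrete product rule. The two terms with [h] cancel: [(g - g0) * h] is put into [b] to make it
   an exact [t]-derivative and taken out again in [K]. *)
have alg (v v0 f f0 g g0 h : R) : v * f - v0 * f0 =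
    s * (v0 * (s^-1 * (f - f0)) - s^-1 * (g - g0) * h) + ((g - g0) * h + (v - v0) * f).
  by field.
exact: alg.
Qed.

Let inI (u : R * R -> R) s : s \in `]-e, e[ -> Ck_on (U := R^o) B setT 0 u ->
  {within I, continuous (fun t => u (s, t) : R^o)}.
Proof. by move=> sI Cu; apply: (within_continuous_snd (e := e)) => //; exact: Cu.1. Qed.

Let aI : approachable I setT.
Proof.
move=> t c tI _; have [h0 h00 hP] := interval_step lt_t01 c tI.
exact: (proper_steps h00 hP).
Qed.

Let C0I (u : R * R -> R) s : s \in `]-e, e[ -> Ck_on (U := R^o) B setT 0 u ->
  Ck_on (U := R^o) I setT 0 (fun t => u (s, t)).
Proof. by move=> sI Cu; split => //; exact: inI. Qed.

Let C0f v s i j : s \in `]-e, e[ ->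
  Ck_on (U := R^o) I setT 0 (fun t => dmap F (gamma s t) (D v (s, t)) i j).
Proof.
move=> sI; apply: (@eq_Ck_on _ _ _ _ _ _ (fun t =>
  derive_within (U := R^o) B (fun p => F (Gamma p) i j) (s, t) v : R^o)).
  by move=> t /set_mem tI; rewrite derive_f//; exact: BI.
exact: (C0I (u := fun p => derive_within (U := R^o) B (fun p => F (Gamma p) i j) p v)).
Qed.

Let C0b s : s \in `]-e, e[ -> Ck_on (U := R^o) I setT 0 (b s).
Proof.
move=> sI; apply: Ck_on_sum => // i _; apply: Ck_on_sum => // j _.
apply: Ck_onD => //; apply: Ck_onM => //.
- by apply: Ck_onB => //; exact: (C0I (u := fun p => Gamma p i j)).
- exact: C0f.
- by apply: Ck_onB => //; exact: (C0I (u := fun p => D (0, 1) p i j)).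
- exact: (C0I (u := fun p => F (Gamma p) i j)).
Qed.

Let C0V s i j : s \in `]-e, e[ -> Ck_on (U := R^o) I setT 0 (fun t => (gamma s t i j)^-1).
Proof.
move=> sI; split => //; apply/within_continuousP => t tI.
apply: cvgV; first by rewrite gt_eqF// (AGamma (BI sI tI)).1.
by have /within_continuousP := inI sI (Cg 0 i j); exact.
Qed.

Let C0K s : s \in `]-e, e[ -> Ck_on (U := R^o) I setT 0 (K s).
Proof.
move=> sI; have Cc (c : R) : Ck_on (U := R^o) I setT 0 (fun=> c) by exact: Ck_on_cst.
apply: Ck_onD => //.
  apply: Ck_onM => //; apply: Ck_on_sum => // i _; apply: Ck_on_sum => // j _.
  apply: Ck_onM => //; last exact: C0V.
  by apply: Ck_onM => //; [apply: Ck_onM => //|]; exact: C0I.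
apply: Ck_on_sum => // i _; apply: Ck_on_sum => // j _.
apply: Ck_onB => //; apply: Ck_onM => //.
- exact: (C0I (u := fun p => D (0, 1) p i j)).
- apply: Ck_onM => //; apply: Ck_onB => //; exact: (C0I (u := fun p => F (Gamma p) i j)).
- apply: Ck_onM => //; apply: Ck_onB => //; exact: (C0I (u := fun p => Gamma p i j)).
- exact: C0f.
Qed.

Let C0L s : s \in `]-e, e[ -> Ck_on (U := R^o) I setT 0 (L s).
Proof.
move=> sI; have Cc (c : R) : Ck_on (U := R^o) I setT 0 (fun=> c) by exact: Ck_on_cst.
apply: Ck_onD => //.
  apply: Ck_onM => //; apply: Ck_on_sum => // i _; apply: Ck_on_sum => // j _.
  apply: Ck_onM => //; last exact: C0V.
  by apply: Ck_onM => //; exact: C0I.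
apply: Ck_on_sum => // i _; apply: Ck_on_sum => // j _; apply: Ck_onM => //.
- exact: (C0I (u := fun p => D (0, 1) p i j)).
- exact: (C0I (u := fun p => F (Gamma p) i j)).
Qed.

Let integral_b s : s \in `]-e, e[ -> \int[mu]_(t in I) b s t = 0.
Proof.
move=> sI; pose c t := \sum_i \sum_j (gamma s t i j - gamma 0 t i j) * F (gamma s t) i j.
rewrite (Rintegral_derive_within lt_t01 (B := c)); last 2 first.
- exact: (C0b sI).1.
- move=> t tI; have G0 := @steps_dnbhs _ _ I t (1 : R).
  apply: quotient_cvg_sum => i _; apply: quotient_cvg_sum => j _.
  have dg r : r \in `]-e, e[ ->
    is_derive_within (U := R^o) I (fun t => gamma r t i j) t 1 (D (0, 1) (r, t) i j).
    move=> rI; apply: (is_derive_within_snd (u := fun p => Gamma p i j) rI).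
    rewrite -(derive_g _ _ _ (BI rI tI)).
    exact: (Ck_on_is_derive (Cg 1 i j) (BI rI tI) Logic.I).
  apply: quotient_cvgM => //; first by apply: quotient_cvgB; exact: dg.
  apply: (is_derive_within_snd (u := fun p => F (Gamma p) i j) sI).
  rewrite -(derive_f _ _ _ (BI sI tI)).
  exact: (Ck_on_is_derive (Cf 1 i j) (BI sI tI) Logic.I).
case: gamma_var => _ _ _ _ ends; have [s0 s1] := ends s sI; have [z0 z1] := ends 0 zI.
have c0 t : gamma s t = gamma 0 t -> c t = 0.
  by move=> st; rewrite /c big1// => i _; rewrite big1// => j _; rewrite st subrr mul0r.
by rewrite !c0 ?subrr// ?s0 ?s1.
Qed.

Lemma action_quotient s : s \in `]-e, e[ -> s != 0 ->
  s^-1 * (action t0 t1 F (gamma s) - action t0 t1 F (gamma 0)) = \int[mu]_(t in I) K s t.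
Proof.
move=> sI s0; rewrite !action_gamma//.
have mI : measurable (I : set (measurableTypeR R)) by exact: measurable_itv.
have iL r : r \in `]-e, e[ -> mu.-integrable I (EFin \o L r).
  by move=> rI; apply: continuous_integrable_itv; exact: (C0L rI).1.
have iK : mu.-integrable I (EFin \o K s).
  by apply: continuous_integrable_itv; exact: (C0K sI).1.
have ib : mu.-integrable I (EFin \o b s).
  by apply: continuous_integrable_itv; exact: (C0b sI).1.
have isK : mu.-integrable I (EFin \o (fun t => s * K s t)).
  apply: continuous_integrable_itv.
  exact: (Ck_onM aI (Ck_on_cst (U := R^o) 0 s aI) (C0K sI)).1.
rewrite -RintegralB//; [|exact: iL|exact: iL].
transitivity (s^-1 * \int[mu]_(t in I) (s * K s t + b s t)).
  by congr (_ * _); apply: eq_Rintegral => t /set_mem tI; rewrite LKb.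
by rewrite RintegralD// integral_b// addr0 RintegralZl// mulKf.
Qed.

Let K0 t : R := \sum_i \sum_j
  (D (0, 1) (0, t) i j * dmap F (W t) (D (1, 0) (0, t)) i j -
   D (1, 0) (0, t) i j * dmap F (W t) (D (0, 1) (0, t)) i j).

Let C0K0 : Ck_on (U := R^o) I setT 0 K0.
Proof.
apply: (@eq_Ck_on _ _ _ _ _ _ (fun t => \sum_i \sum_j
  (D (0, 1) (0, t) i j * dmap F (gamma 0 t) (D (1, 0) (0, t)) i j -
   D (1, 0) (0, t) i j * dmap F (gamma 0 t) (D (0, 1) (0, t)) i j) : R^o)).
  by move=> t /set_mem tI; rewrite /K0 gamma0.
apply: Ck_on_sum => // i _; apply: Ck_on_sum => // j _.
apply: Ck_onB => //; apply: Ck_onM => //.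
- exact: (C0I (u := fun p => D (0, 1) p i j)).
- exact: (@C0f (1, 0) 0 i j zI).
- exact: (C0I (u := fun p => D (1, 0) p i j)).
- exact: (@C0f (0, 1) 0 i j zI).
Qed.

Let d : R := e / 2.
Let d0 : 0 < d. Proof. by rewrite divr_gt0. Qed.
Let de : d < e. Proof. by rewrite ltr_pdivrMr// ltr_pMr// ltr1n. Qed.

Let bounded_u (u : R * R -> R) : Ck_on (U := R^o) B setT 0 u ->
  bounded_family t0 t1 d (fun s t => u (s, t)).
Proof.
move=> Cu; have [C C0 CP] := rectangle_bounded de Cu.1.
by exists C => s t sd _ tI; apply: CP => //; exact: ltW.
Qed.

Let bounded_quotient (u : R * R -> R) : Ck_on (U := R^o) B setT 1 u ->
  bounded_family t0 t1 d (fun s t => s^-1 * (u (s, t) - u (0, t))).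
Proof.
move=> Cu; have [C C0 CP] := rectangle_lipschitz d0 de Cu.
exists C => s t sd s0 tI; rewrite normrM normfV ler_pdivrMl ?normr_gt0// mulrC.
by apply: CP => //; exact: ltW.
Qed.

Let bounded_K : bounded_family t0 t1 d K.
Proof.
have bd (u : R * R -> R) : Ck_on (U := R^o) B setT 0 u ->
    bounded_family t0 t1 d (fun s t => u (0, t)).
  move=> Cu; have [C C0 CP] := rectangle_bounded de Cu.1.
  by exists C => s t sd _ tI; apply: CP => //; rewrite normr0 ltW.
apply: bounded_familyD.
  apply: bounded_familyM; first exact: bounded_family_cst.
  apply: bounded_family_sum => i; apply: bounded_family_sum => j.
  apply: bounded_familyM.
    apply: bounded_familyM; last exact: bounded_u.
    (* As [y] vanishes at [s = 0], the product [s^-1 * y] is a difference quotient in [s]. *)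
    have [C CP] := bounded_quotient (Cy 1 i j); exists C => s t sd s0 tI.
    by have := CP s t sd s0 tI; rewrite y0// subr0.
  apply: (bounded_u (u := fun p => (Gamma p i j)^-1)); split => //.
  apply/within_continuousP => p Bp; apply: cvgV; first by rewrite gt_eqF// (AGamma Bp).1.
  by have /within_continuousP := (Cg 0 i j).1; exact.
apply: bounded_family_sum => i; apply: bounded_family_sum => j.
apply: bounded_familyB; apply: bounded_familyM.
- exact: (bd (fun p => D (0, 1) p i j)).
- exact: (bounded_quotient (u := fun p => F (Gamma p) i j)).
- exact: (bounded_quotient (u := fun p => Gamma p i j)).
- have [C CP] := bounded_u (Cdf (0, 1) i j).
  exists C => s t sd s0 tI; have := CP s t sd s0 tI; rewrite derive_f//.
  by apply: BI => //; rewrite in_itv/= -ltr_norml (lt_trans sd).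
Qed.

Let cvg_K t : t \in `[t0, t1] -> K s t @[s --> 0^'] --> K0 t.
Proof.
move=> tI; have B0 := BI zI tI.
have cu (u : R * R -> R) : Ck_on (U := R^o) B setT 0 u -> u (s, t) @[s --> 0^'] --> u (0, t).
  by move=> Cu; exact: (cvg_fst_within e0 tI Cu.1).
have qu (u : R * R -> R) : Ck_on (U := R^o) B setT 1 u ->
    s^-1 * (u (s, t) - u (0, t)) @[s --> 0^'] --> derive_within (U := R^o) B u (0, t) (1, 0).
  move=> Cu; have := quotient_cvg_fst zI tI Cu.
  by apply: cvg_trans; apply: near_eq_cvg; near=> s; rewrite add0r.
(* A zero is added so that the limit has the two-part shape of [K]: the square part tends to the
   [s]-derivative of [y] times [y] at [s = 0], which vanishes. *)
have -> : K0 t = 2^-1 * (\sum_i \sum_j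
    derive_within (U := R^o) B (y i j) (0, t) (1, 0) * y i j (0, t) / gamma 0 t i j) + K0 t.
  rewrite [Q in 2^-1 * Q]big1 ?mulr0 ?add0r// => i _; rewrite big1// => j _.
  by rewrite y0// mulr0 mul0r.
apply: cvgD.
  apply: cvgM; first exact: cvg_cst.
  apply: (cvg_sum (U := R^o)) => i _; apply: (cvg_sum (U := R^o)) => j _.
  apply: cvgM; last first.
    apply: cvgV; first by rewrite gt_eqF// (AGamma B0).1.
    exact: (cu (fun p => Gamma p i j)).
  apply: cvgM; last exact: cu.
  have := qu _ (Cy 1 i j); apply: cvg_trans; apply: near_eq_cvg; near=> s.
  by rewrite y0// subr0.
apply: (cvg_sum (U := R^o)) => i _; apply: (cvg_sum (U := R^o)) => j _.
rewrite -(gamma0 tI); apply: cvgB; apply: cvgM; first exact: cvg_cst.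
- have /= <- := derive_f (1, 0) i j B0; exact: (qu (fun p => F (Gamma p) i j)).
- have /= <- := derive_g (1, 0) i j B0; exact: (qu (fun p => Gamma p i j)).
- have := cu _ (Cdf (0, 1) i j).
  rewrite derive_f//; apply: cvg_trans; apply: near_eq_cvg.
  have /nbhs_dnbhs := near_in_itvoo zI; apply: filterS => s sI.
  by rewrite derive_f//; exact: BI.
Unshelve. all: by end_near. Qed.

Lemma first_variation : is_derive (0 : R) (1 : R) (fun s => action t0 t1 F (gamma s))
  (\int[mu]_(t in I)
    (mx_inner (X (W t)) (dmap F (W t) (D (1, 0) (0, t))) -
     mx_inner (D (1, 0) (0, t)) (dmap F (W t) (X (W t))))).
Proof.
apply: quotient_cvg_is_derive.
have [C CP] := bounded_K.
have sub s : `|s| < d -> s \in `]-e, e[ by move=> sd; rewrite in_itv/= -ltr_norml (lt_trans sd).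
have := @cvg_Rintegral_dominated _ t0 t1 K K0 C d d0 _ C0K0.1 CP cvg_K.
move=> /(_ (fun s sd _ => (C0K (sub s sd)).1)).
have -> : \int[mu]_(t in I) K0 t = \int[mu]_(t in I)
    (mx_inner (X (W t)) (dmap F (W t) (D (1, 0) (0, t))) -
     mx_inner (D (1, 0) (0, t)) (dmap F (W t) (X (W t)))).
  apply: eq_Rintegral => t /set_mem tI; rewrite /K0 -(velocity_variation0 tI) !mx_innerE -sumrB.
  by apply: eq_bigr => i _; rewrite -sumrB.
apply: cvg_trans; apply: near_eq_cvg.
have /nbhs_dnbhs nI := near_in_itvoo zI.
have hn0 : \forall h \near (0 : R)^', h != 0 by exact: nbhs_dnbhs_neq.
by apply: filterS2 nI hn0 => s sI s0; rewrite add0r -action_quotient.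
Qed.

End FirstVariation.

(** * The test variation *)

Section TestVariation.
Context {R : realType} {m n : nat}.
Local Notation M := 'M[R]_(m, n).
Local Notation A := (@assignment_manifold R m n).
Local Notation T := (@T0 R m n).
Variable F : M -> M.
Hypothesis F_smooth : smooth_on A T F.
Local Notation X P := (replicator P (F P)).
Variables (t0 t1 : R) (lt_t01 : t0 < t1).
Local Notation I := [set` `[t0, t1]].
Variable W : R -> M.
Hypothesis W_flow : assignment_flow t0 t1 F W.

(** Formed with the explicit [adjoint_mx] because the test variation built from it has to be smooth;
    against tangent matrices it pairs like [T0_adjoint]. *)
Definition antisymmetric_defect P : M := dmap F P (X P) - adjoint_mx F P (X P).

Local Notation Z := antisymmetric_defect.
Local Notation E P := (replicator P (Z P)).

Lemma smooth_coords_defect : smooth_coords Z.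
Proof.
have Xs := smooth_coords_replicator (smooth_coords_F F_smooth).
apply: smooth_coordsB; last exact: smooth_coords_adjoint_mx.
by apply: smooth_coords_dmap => // P AP; exact: T0_replicator.
Qed.

Lemma symmetry_condition_defect t : t \in `[t0, t1] ->
  0 = replicator (W t) (dmap F (W t) (X (W t)) - T0_adjoint (dmap F (W t)) (X (W t))) <->
  E (W t) = 0.
Proof.
move=> tI; have AW := flow_manifold W_flow tI; have TX := T0_flow W_flow tI.
apply: (iff_trans (symmetry_conditionE F_smooth AW TX)).
have dual V : T V -> mx_inner V (Z (W t)) =
    mx_inner V (dmap F (W t) (X (W t))) - mx_inner (X (W t)) (dmap F (W t) V).
  by move=> TV; rewrite mx_innerBr -mx_inner_adjoint_mx// [mx_inner (dmap _ _ _) _]mx_innerC.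
split=> [sym|E0 V TV].
  by apply/esym/replicator_eq0P => // V TV; rewrite dual// sym// subrr.
by apply/eqP; rewrite -subr_eq0 -dual// ((replicator_eq0P _ AW).1 (esym E0)).
Qed.

Definition bump t : R := (t - t0) * (t1 - t).

(* Varying W in the direction of the defect itself makes the first variation
   - \int bump * <R_W Z, Z>, whose integrand has a sign, so that no cut-off
   functions are needed. *)
Definition test_variation (s t : R) : M := W t + s *: (bump t *: E (W t)).

Lemma bump_continuous : continuous bump.
Proof.
move=> t; apply: cvgM; first by apply: cvgB; [exact: cvg_id|exact: cvg_cst].
by apply: cvgB; [exact: cvg_cst|exact: cvg_id].
Qed.

Lemma bump_gt0 t : t \in `]t0, t1[ -> 0 < bump t.
Proof. by rewrite in_itv/= => /andP[t0t tt1]; rewrite mulr_gt0// subr_gt0. Qed.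

Lemma bump_ge0 t : t \in `[t0, t1] -> 0 <= bump t.
Proof. by rewrite in_itv/= => /andP[t0t tt1]; rewrite mulr_ge0// subr_ge0. Qed.

Lemma within_continuous_flow (G : M -> R) : Ck_on (U := R^o) A T 0 G ->
  {within I, continuous (fun t => G (W t))}.
Proof.
move=> Gc; apply: (within_continuous_manifold_comp (B := I) (Gamma := W)) => //.
  by move=> t tI; exact: (flow_manifold W_flow tI).
by apply/within_continuousP => t tI; exact: is_derive_within_cvg (W_flow tI).2.
Qed.

Lemma within_continuous_bump_flow (G : M -> R) : Ck_on (U := R^o) A T 0 G ->
  {within I, continuous (fun t => bump t * G (W t))}.
Proof.
move=> Gc; have /within_continuousP Gw := within_continuous_flow Gc.
apply/within_continuousP => t tI; apply: cvgM; last exact: Gw.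
by apply: cvg_within_filter; exact: bump_continuous.
Qed.

(** On the compact interval the entry of [W] has a positive minimum and the direction of variation
    is bounded, so one range of [s] serves all [t]. *)
Lemma test_variation_pos i j : \forall s \near (0 : R),
  forall t, t \in `[t0, t1] -> 0 < test_variation s t i j.
Proof.
have [c cI cmin] := EVT_min (ltW lt_t01)
  (within_continuous_flow (Ck_on_coordinate (R := R) 0 i j)).
have := within_continuous_bump_flow (smooth_coords_replicator smooth_coords_defect 0 i j).
move=> /continuous_compact /(_ (@segment_compact _ t0 t1)) /compact_bounded[C [_ CP]].
have Wc : 0 < W c i j by exact: (flow_manifold W_flow cI).1.
pose k := `|C| + 1; have k0 : 0 < k by rewrite ltr_wpDl.
apply/nbhs_ballP; exists (W c i j / k); first by rewrite /= divr_gt0.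
move=> s; rewrite -ball_normE/= sub0r normrN ltr_pdivlMr// => sk t tI.
rewrite [test_variation s t]/(_ + _) mxE [Q in _ + Q]mxE [Q in s * Q]mxE.
rewrite -[s * _]opprK subr_gt0; apply: le_lt_trans (ler_norm _) _.
rewrite normrN normrM; apply: lt_le_trans (cmin t tI); apply: le_lt_trans sk.
apply: ler_wpM2l => //; apply: (CP k); first by apply: le_lt_trans (ler_norm C) _; rewrite ltrDl.
by exists t.
Qed.

Lemma variation_test_variation : exists e, Defs.variation t0 t1 W e test_variation.
Proof.
have AW := flow_manifold W_flow.
have : \forall s \near (0 : R), forall i j t, t \in `[t0, t1] -> 0 < test_variation s t i j.
  refine (@filter_forall _ _
    (fun i s => forall j t, t \in `[t0, t1] -> 0 < test_variation s t i j)
    (nbhs (0 : R)) _ _) => i.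
  refine (@filter_forall _ _
    (fun j s => forall t, t \in `[t0, t1] -> 0 < test_variation s t i j)
    (nbhs (0 : R)) _ _) => j.
  exact: test_variation_pos.
move=> /nbhs_ballP[e /= e0 eP]; exists e; split => //.
- move=> k.
  have aR : approachable (rectangle t0 t1 e) setT by exact: approachable_rectangle.
  have c1 : Ck_on (U := R^o) (rectangle t0 t1 e) setT k (fun p => p.1).
    by apply: Ck_on_linear => // p; exact: cvg_fst.
  have c2 : Ck_on (U := R^o) (rectangle t0 t1 e) setT k (fun p => p.2).
    by apply: Ck_on_linear => // p; exact: cvg_snd.
  apply: Ck_onD => //; first exact: Ck_on_flow.
  apply: Ck_onZ => //; apply: Ck_onZ => //.
    by apply: Ck_onM => //; apply: Ck_onB => //; exact: Ck_on_cst.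
  apply: Ck_on_mx => // i j.
  apply: (Ck_on_comp (Gamma := fun p => W p.2) aR _ (G := fun P => E P i j)).
  + by move=> p [_ /AW].
  + exact: Ck_on_flow.
  + exact: smooth_coords_replicator smooth_coords_defect k i j.
- move=> s t sI tI; apply: manifold_shift; first exact: AW.
    by do 2 apply: T0_Z; apply: T0_replicator; exact: AW.
  move=> i j; apply: eP => //.
  by rewrite -ball_normE/= sub0r normrN ltr_norml; move: sI; rewrite in_itv.
- by move=> t _; rewrite /test_variation scale0r addr0.
- by move=> s _; rewrite /test_variation /bump !subrr mul0r mulr0 !scale0r !scaler0 !addr0.
Qed.

Lemma derive_test_variation e t : 0 < e -> t \in `[t0, t1] ->
  derive_within (rectangle t0 t1 e) (fun p => test_variation p.1 p.2) (0, t) (1, 0) =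
  bump t *: E (W t).
Proof.
move=> e0 tI; have zI : 0 \in `]-e, e[ by rewrite in_itv/= oppr_lt0 e0.
apply: derive_within_val; first by apply: approachable_rectangle => //; split.
rewrite is_derive_withinE.
have := quotient_cvg_line (v := bump t *: E (W t)) (W t)
  (steps_filter (rectangle t0 t1 e) (0, t) (1, 0)) (@steps_dnbhs _ _ _ _ _).
apply: cvg_trans; apply: near_eq_cvg; near=> h.
have -> : (0, t) + h *: (1, 0) = (h, t) :> R * R.
  by congr pair => /=; [rewrite [h *: _]mulr1 add0r|rewrite [h *: _]mulr0 addr0].
by rewrite /test_variation /= scale0r addr0.
Unshelve. all: by end_near. Qed.

Lemma critical_defect_eq0 : critical_point t0 t1 (action t0 t1 F) W ->
  forall t, t \in `[t0, t1] -> E (W t) = 0.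
Proof.
move=> crit; have [e evar] := variation_test_variation.
have e0 : 0 < e by case: evar.
have [_ d0] := crit _ _ evar.
have [_] := first_variation F_smooth lt_t01 W_flow evar; rewrite d0 => /esym int0.
pose G P := mx_inner (E P) (Z P).
have Gs : Ck_on (U := R^o) A T 0 G.
  apply: (@eq_Ck_on _ _ _ _ _ _ (fun P => \sum_i \sum_j E P i j * Z P i j : R^o)).
    by move=> P _; rewrite /G mx_innerE.
  have aAT := @approachable_manifold R m n.
  apply: Ck_on_sum => // i _; apply: Ck_on_sum => // j _.
  apply: Ck_onM => //; last exact: smooth_coords_defect.
  exact: smooth_coords_replicator smooth_coords_defect 0 i j.
have qc := within_continuous_bump_flow Gs.
have q0 : \int[lebesgue_measure]_(t in I) (bump t * G (W t)) = 0.
  apply/eqP; rewrite -oppr_eq0 -mulN1r -RintegralZl; last 2 first.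
  - exact: measurable_itv.
  - exact: continuous_integrable_itv.
  apply/eqP; rewrite -[RHS]int0; apply: eq_Rintegral => t /set_mem tI.
  have AW := flow_manifold W_flow tI.
  rewrite derive_test_variation// /G.
  have TE : T (bump t *: E (W t)) by apply: T0_Z; exact: T0_replicator.
  (* Once the differential is moved off the variation field by the adjoint, the two terms combine to
     minus the pairing of that field with the defect. *)
  rewrite [mx_inner (X _) _]mx_innerC mx_inner_adjoint_mx// -opprB -mx_innerBr -/(Z _).
  by rewrite mx_innerZl mulN1r.
have Goo t : t \in `]t0, t1[ -> E (W t) = 0.
  move=> tI; have AW := flow_manifold W_flow (subset_itv_oo_cc tI).
  apply: replicator_eq0 => //.
  have q_ge0 u : u \in `[t0, t1] -> 0 <= bump u * G (W u).
    move=> uI; rewrite mulr_ge0 ?bump_ge0//.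
    by apply: mx_inner_replicator_ge0; exact: (flow_manifold W_flow uI).
  have /eqP := Rintegral_continuous_eq0 lt_t01 qc q_ge0 q0 tI.
  by rewrite mulf_eq0 gt_eqF ?bump_gt0//= => /eqP.
move=> t tI; apply/matrixP => i j; rewrite [RHS]mxE.
apply: (within_continuous_eq0 lt_t01 (f := fun t => E (W t) i j)) => //.
  exact: within_continuous_flow (smooth_coords_replicator smooth_coords_defect 0 i j).
by move=> u uI; rewrite Goo// mxE.
Qed.

End TestVariation.

(** * Equivalence of criticality, the symmetry condition and the Euler-Lagrange equation *)

Theorem theorem3p3 (R : realType) (m n : nat) (m_gt0 : (0 < m)%N) (n_gt0 : (0 < n)%N)
    (nabla : ('M[R]_(m, n) -> 'M[R]_(m, n)) -> ('M[R]_(m, n) -> 'M[R]_(m, n)) ->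
             'M[R]_(m, n) -> 'M[R]_(m, n))
    (nabla_lc : levi_civita nabla)
    (F : 'M[R]_(m, n) -> 'M[R]_(m, n))
    (F_smooth : smooth_on assignment_manifold T0 F)
    (t0 t1 : R) (lt_t01 : t0 < t1)
    (W : R -> 'M[R]_(m, n)) (W_flow : assignment_flow t0 t1 F W) :
  let condition := forall t, t \in `[t0, t1] ->
    0 = replicator (W t)
          (dmap F (W t) (replicator (W t) (F (W t))) -
           T0_adjoint (dmap F (W t)) (replicator (W t) (F (W t)))) in
  let euler_lagrange := forall t, t \in `[t0, t1] ->
    covariant_derivative t0 t1 nabla W (velocity t0 t1 W) t =
      2^-1 *: \sum_i rgrad (fun P => var (rowc P i) (rowc (F P) i)) (W t) in
  (critical_point t0 t1 (action t0 t1 F) W <-> condition) /\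
  (condition <-> euler_lagrange).
Proof.
move=> condition euler_lagrange.
have sym t : t \in `[t0, t1] -> _ :=
  fun tI => symmetry_conditionE F_smooth (flow_manifold W_flow tI) (T0_flow W_flow tI).
have el t : t \in `[t0, t1] -> _ := fun tI => euler_lagrangeE F_smooth lt_t01 W_flow nabla_lc tI.
split; last first.
  by split=> H t tI; have := H t tI; [move/(sym t tI)/(el t tI)|move/(el t tI)/(sym t tI)].
split=> [crit t tI|cond e gamma evar].
  apply/(symmetry_condition_defect F_smooth W_flow tI).
  exact: critical_defect_eq0 crit t tI.
have zI : 0 \in `]-e, e[ by rewrite in_itv/= oppr_lt0; case: evar => ->.
apply: is_derive_eq; first exact: (first_variation F_smooth lt_t01 W_flow evar).
(* The variation field is tangent at every [t], so the symmetry condition makes the integrand vanish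
   pointwise. *)
transitivity (\int[lebesgue_measure]_(t in [set` `[t0, t1]]) (0 : R)).
  apply: eq_Rintegral => t /set_mem tI.
  apply/eqP; rewrite subr_eq0 eq_sym; apply/eqP; apply: ((sym t tI).1 (cond t tI)).
  by apply: (T0_variation lt_t01 evar); split.
by rewrite Rintegral_cst ?mul0r//; exact: measurable_itv.
Qed.
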